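(* Let $A=(a_{i,j})_{i,j\in\mathbb{Z}}$ be the matrix with $a_{i,j}=1$ if $i\geq j$ and $a_{i,j}=0$ otherwise, and let $O_A$ be the associated Exel-Laca $C^*$-algebra. Then $O_A$ is not a $C^*$-algebra of type I.
   Context: For finite subsets $X,Y\subset\mathbb{Z}$ and $j\in\mathbb{Z}$ put $a(X,Y,j)=\prod_{x\in X}a_{x,j}\prod_{y\in Y}(1-a_{y,j})$ (empty products equal $1$). $O_A$ is the universal $C^*$-algebra generated by partial isometries $\{s_i:i\in\mathbb{Z}\}$, with $q_i=s_i^*s_i$, $p_i=s_is_i^*$, subject to: (1) $q_iq_j=q_jq_i$ for all $i,j$; (2) $p_ip_j=0$ for $i\neq j$; (3) $q_ip_j=a_{i,j}p_j$ for all $i,j$; (4) $\prod_{x\in X}q_x\prod_{y\in Y}(1-q_y)=\sum_{j\in\mathbb{Z}}a(X,Y,j)p_j$ for all finite $X,Y\subset\mathbb{Z}$ such that $a(X,Y,j)\neq 0$ for only finitely many $j$ (the products being computed in the unitization). *)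

(* Defs.v *)
From HB Require Import structures.
From mathcomp Require Import all_boot all_order all_algebra finmap complex.
From mathcomp Require Import all_classical all_reals all_analysis.

Set Implicit Arguments.
Unset Strict Implicit.
Unset Printing Implicit Defensive.

Import Order.TTheory GRing.Theory Num.Theory.
Import numFieldNormedType.Exports.

Local Open Scope classical_set_scope.
Local Open Scope fset_scope.
Local Open Scope complex_scope.
Local Open Scope ring_scope.

(* MathComp rings have a unit, so the product is introduced from scratch on top
   of a complex Banach space. *)
HB.mixin Record isCStarAlgebra (R : realType) A
    & CompleteNormedModule R[i] A := {
  cmul : A -> A -> A ;
  star : A -> A ;
  cmulA : associative cmul ;
  cmulDl : left_distributive cmul +%R ;
  cmulDr : right_distributive cmul +%R ;
  cmulZl : forall (c : R[i]) x y, cmul (c *: x) y = c *: cmul x y ;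
  cmulZr : forall (c : R[i]) x y, cmul x (c *: y) = c *: cmul x y ;
  starK : involutive star ;
  starD : {morph star : x y / x + y} ;
  starZ : forall (c : R[i]) x, star (c *: x) = conjc c *: star x ;
  starM : forall x y, star (cmul x y) = cmul (star y) (star x) ;
  ler_cmul : forall x y, `|cmul x y| <= `|x| * `|y| ;
  cstar_id : forall x, `|cmul (star x) x| = `|x| ^+ 2
}.

#[short(type="cstarAlgType")]
HB.structure Definition CStarAlgebra (R : realType) :=
  {A of isCStarAlgebra R A & CompleteNormedModule R[i] A}.

Notation "x ** y" := (cmul x y) (at level 40, left associativity) : ring_scope.

Definition star_hom (R : realType) (A B : cstarAlgType R) (f : A -> B) : Prop :=
  [/\ linear f, {morph f : x y / x ** y} & {morph f : x / star x}].

Definition star_generates (R : realType) (A : cstarAlgType R) (I : Type)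
    (s : I -> A) : Prop :=
  forall S : set A,
    closed S ->
    S 0 ->
    (forall (c : R[i]) x y, S x -> S y -> S (c *: x + y)) ->
    (forall x y, S x -> S y -> S (x ** y)) ->
    (forall x, S x -> S (star x)) ->
    (forall i, S (s i)) ->
    S = setT.

Section Unitization.
Context (R : realType) (A : cstarAlgType R).

(* The unitization of A, where (a, c) stands for a + c1; its additive structure
   is that of the product. *)
Definition uone : A * R[i] := (0, 1).

Definition umul (u v : A * R[i]) : A * R[i] :=
  (u.1 ** v.1 + u.2 *: v.1 + v.2 *: u.1, u.2 * v.2).

Definition uinj (a : A) : A * R[i] := (a, 0).

End Unitization.

Section ExelLaca.
Context (R : realType) (a : int -> int -> bool).

Definition el_coef (X Y : {fset int}) (j : int) : R[i] :=
  (\prod_(x <- X) (a x j)%:R) * (\prod_(y <- Y) (1 - (a y j)%:R)).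

Definition partial_isometry (A : cstarAlgType R) (s : A) : Prop :=
  s ** star s ** s = s.

Definition el_relations (A : cstarAlgType R) (s : int -> A) : Prop :=
  let q i := star (s i) ** s i in
  let p i := s i ** star (s i) in
  [/\ forall i, partial_isometry (s i),
      forall i j, q i ** q j = q j ** q i,
      forall i j, i != j -> p i ** p j = 0,
      forall i j, q i ** p j = (a i j)%:R *: p j &
      forall X Y : {fset int},
        finite_set [set j | el_coef X Y j != 0] ->
        umul (\big[@umul R A/@uone R A]_(x <- X) uinj (q x))
             (\big[@umul R A/@uone R A]_(y <- Y) (uone A - uinj (q y)))
        = uinj (\sum_(j \in [set: int]) el_coef X Y j *: p j) ].

(* O, with the family s, is the universal C*-algebra generated by partial
   isometries subject to the relations; this determines (O, s) up to a unique
   *-isomorphism. *)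
Definition is_exel_laca (O : cstarAlgType R) (s : int -> O) : Prop :=
  [/\ el_relations s,
      star_generates s &
      forall (B : cstarAlgType R) (t : int -> B), el_relations t ->
        exists! f : O -> B, star_hom f /\ forall i, f (s i) = t i ].

End ExelLaca.

(* The inner product is linear in its first argument. *)
HB.mixin Record isHilbert (R : realType) H & CompleteNormedModule R[i] H := {
  hdot : {dot H for (@conjc R)} ;
  sqr_norm_hdot : forall x : H, `|x| ^+ 2 = hdot x x
}.

#[short(type="hilbertType")]
HB.structure Definition Hilbert (R : realType) :=
  {H of isHilbert R H & CompleteNormedModule R[i] H}.

Section VonNeumann.
Context (R : realType) (H : hilbertType R).
Implicit Types (M : set (H -> H)) (T e z : H -> H).

Definition bounded_op T : Prop := linear T /\ continuous T.

Definition commutant M : set (H -> H) :=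
  [set T | bounded_op T /\ forall V, M V -> T \o V = V \o T].

Definition projection e : Prop :=
  [/\ bounded_op e, e \o e = e & forall x y, hdot (e x) y = hdot x (e y)].

Definition abelian_projection M e : Prop :=
  [/\ projection e, M e &
      forall S T, M S -> M T ->
        (e \o S \o e) \o (e \o T \o e) = (e \o T \o e) \o (e \o S \o e) ].

(* Every nonzero central projection of M dominates a nonzero abelian one. *)
Definition type_I_vN M : Prop :=
  forall z, projection z -> M z -> commutant M z -> z <> cst 0 ->
    exists e, [/\ abelian_projection M e, e <> cst 0 & z \o e = e].

End VonNeumann.

Section TypeI.
Context (R : realType) (A : cstarAlgType R).

Definition representation (H : hilbertType R) (pi : A -> H -> H) : Prop :=
  [/\ forall x, bounded_op (pi x),
      forall (c : R[i]) x y h, pi (c *: x + y) h = c *: pi x h + pi y h,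
      forall x y, pi (x ** y) = pi x \o pi y &
      forall x h k, hdot (pi (star x) h) k = hdot h (pi x k) ].

Definition nondegenerate_rep (H : hilbertType R) (pi : A -> H -> H) : Prop :=
  forall S : set H,
    closed S ->
    S 0 ->
    (forall (c : R[i]) h k, S h -> S k -> S (c *: h + k)) ->
    (forall x h, S (pi x h)) ->
    S = setT.

(* commutant (commutant (range pi)) is the von Neumann algebra generated by the
   nondegenerate representation pi. *)
Definition type_I : Prop :=
  forall (H : hilbertType R) (pi : A -> H -> H),
    representation pi -> nondegenerate_rep pi ->
    type_I_vN (commutant (commutant (range pi))).

End TypeI.

(* Main.v *)
From HB Require Import structures.
Require Import Defs.
From mathcomp Require Import all_boot all_order all_algebra finmap complex.
From mathcomp Require Import all_classical all_reals all_analysis.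
From mathcomp Require Import summability ring lra zify.

Set Implicit Arguments.
Unset Strict Implicit.
Unset Printing Implicit Defensive.

Import Order.TTheory GRing.Theory Num.Theory.
Import numFieldNormedType.Exports.

Local Open Scope classical_set_scope.
Local Open Scope fset_scope.
Local Open Scope complex_scope.
Local Open Scope ring_scope.

(** The letters of a non-increasing integer sequence that tends to -oo are
    described by their multiplicities, and two such sequences have a common tail
    exactly when their multiplicities agree far down. So the dynamics of O_A is
    tail equivalence in a product over the levels going to -oo, which has
    representations that are not of type I. The proof exhibits one such
    representation and shows that its bicommutant has no nonzero abelian
    projection.

    The representation acts on a tensor product, over all levels k, of spaces
    with basis the pairs (m, c) of a multiplicity m and a bit c. The reference
    vector is (0, false) at the positive levels, and the maximally entangled
    vector ((0, false) + (1, true)) / sqrt 2 at the other ones. The generator at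
    level j projects the multiplicities above j to 0 and then raises the one at
    level j. The initial projections q_j increase with j, the final projections
    are q_j - q_(j-1), and for the matrix at hand this is all that the relations
    ask ('el_relations_of_nested', 'gen_relations'). An infinite tensor product
    is realized as the square-summable families on the finitely supported
    configurations of labels, after a rotation ('hadamard') that makes the
    reference vector a basis vector at each level.

    To apply the universal property of O_A, the bounded adjointable operators on
    a Hilbert space are made into a C*-algebra ('bop'). The bits are
      untouched by
    the generators. The bit flip and the bit sign at level -i are therefore
    symmetries that commute with the generators, and lie in the commutant: this
    is the uniqueness half of the universal property ('symmetry_commutant'). The
    flip and the sign of the multiplicities 0 and 1 at level -i lie in the
    bicommutant, because on each configuration of the higher levels they are
    given by words in the generators ('bicommutant_of_corner').

    On the maximally entangled vector, an operator on the multiplicity and the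
    same operator on the bit agree. Since every vector of the space is close to
    one that is the reference vector at level -i when i is large, the operators
    of the bicommutant and those of the commutant become strongly close as i
    grows ('diff_small'). An abelian projection e of the bicommutant commutes
    with the commutant, hence asymptotically with the flip and the sign of the
    multiplicity; these then commute asymptotically under e, whereas they are
    close to the anticommuting unitaries on the bit. So e = 0
    ('abelian_projection_eq0'). *)

(** * Unconditional sums of real families *)

#[local] Existing Instance totally_filter.

Section Sums.
Context {R : realType} {I : choiceType}.
Implicit Types (x y : I -> R) (F : {fset I}).

Definition abs_summable x := exists M, forall F, \sum_(i <- F) `|x i| <= M.

Definition fin_sum x F : R := \sum_(i <- F) x i.

Definition real_sum x : R := lim (fin_sum x @ totally).

Lemma fin_sum_subset x F G :
  (forall i, 0 <= x i) -> F `<=` G -> fin_sum x F <= fin_sum x G.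
Proof.
move=> x0 FG; rewrite /fin_sum (big_fsetID _ (mem F) G) /=.
have -> : [fset i | i in G & i \in F] = F.
  apply/fsetP => i; rewrite !inE /= andbC; case: (boolP (i \in F)) => //= iF.
  by rewrite (fsubsetP FG).
by rewrite lerDl sumr_ge0.
Qed.

Lemma ge0_fin_sum_cvg x : (forall i, 0 <= x i) -> abs_summable x ->
  fin_sum x @ totally --> sup (range (fin_sum x)).
Proof.
move=> x0 [M xM].
have hs : has_sup (range (fin_sum x)).
  split; first by exists (fin_sum x fset0); exists fset0.
  exists M => _ [F _ <-]; rewrite (le_trans _ (xM F))//.
  by rewrite ler_sum// => i _; rewrite ler_norm.
apply/cvgrPdist_le => e e0.
have [_ [F _ <-] eF] := sup_adherent e0 hs.
exists F => // G /= FG; rewrite ger0_norm.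
  by rewrite lerBlDl -lerBlDr (le_trans (ltW eF))// fin_sum_subset.
by rewrite subr_ge0; apply: ub_le_sup; [case: hs|exists G].
Qed.

Lemma abs_summable_dom x y :
  abs_summable y -> (forall i, `|x i| <= y i) -> abs_summable x.
Proof.
move=> [M yM] xy; exists M => F; apply: le_trans (yM F).
by apply: ler_sum => i _; rewrite (le_trans (xy i))// ler_norm.
Qed.

Lemma abs_summableD x y : abs_summable x -> abs_summable y ->
  abs_summable (fun i => x i + y i).
Proof.
move=> [M xM] [N yN]; exists (M + N) => F.
apply: le_trans (lerD (xM F) (yN F)); rewrite -big_split /=.
by apply: ler_sum => i _; rewrite ler_normD.
Qed.

Lemma abs_summableZ c x : abs_summable x -> abs_summable (fun i => c * x i).
Proof.
move=> [M xM]; exists (`|c| * M) => F.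
rewrite (eq_bigr (fun i => `|c| * `|x i|)) => [|i _]; last exact: normrM.
by rewrite -mulr_sumr ler_wpM2l.
Qed.

Lemma abs_summable_norm x : abs_summable x -> abs_summable (fun i => `|x i|).
Proof. by move=> [M xM]; exists M => F; under eq_bigr do rewrite normr_id. Qed.

Lemma fin_sumD x y F : fin_sum (fun i => x i + y i) F =
  fin_sum x F + fin_sum y F.
Proof. by rewrite /fin_sum big_split. Qed.

Lemma fin_sumZ c x F : fin_sum (fun i => c * x i) F = c * fin_sum x F.
Proof. by rewrite /fin_sum mulr_sumr. Qed.

(** Reduces to families of nonnegative terms, whose partial sums increase to
    their supremum, by writing x as (|x| + x) - |x|. *)
Lemma abs_summable_cvg x : abs_summable x -> fin_sum x @ totally --> real_sum x.
Proof.
move=> sx; apply/cvg_ex.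
have sa := abs_summable_norm sx.
have c1 := @ge0_fin_sum_cvg (fun i => `|x i|) (fun i => normr_ge0 _) sa.
have c2 := @ge0_fin_sum_cvg (fun i => `|x i| + x i) _ (abs_summableD sa sx).
eexists; rewrite (_ : fin_sum x =
    fin_sum (fun i => `|x i| + x i) \- fin_sum (fun i => `|x i|)).
  apply: cvgB; [apply: c2|exact: c1] => i.
  by rewrite -lerBlDr sub0r -normrN ler_norm.
by apply/funext => F /=; rewrite fin_sumD addrAC subrr add0r.
Qed.

Lemma real_sumE x l : fin_sum x @ totally --> l -> real_sum x = l.
Proof. by move=> xl; apply/cvg_lim. Qed.

Lemma real_sumD x y : abs_summable x -> abs_summable y ->
  real_sum (fun i => x i + y i) = real_sum x + real_sum y.
Proof.
move=> sx sy; apply: real_sumE.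
rewrite (_ : fin_sum _ = fin_sum x \+ fin_sum y);
  last by apply/funext=> F; exact: fin_sumD.
by apply: cvgD; exact: abs_summable_cvg.
Qed.

Lemma real_sumZ c x : abs_summable x ->
  real_sum (fun i => c * x i) = c * real_sum x.
Proof.
move=> sx; apply: real_sumE.
rewrite (_ : fin_sum _ = (fun F => c * fin_sum x F)); last first.
  by apply/funext=> F; exact: fin_sumZ.
by apply: cvgMr; exact: abs_summable_cvg.
Qed.

Lemma ge0_fin_sum_le x F : (forall i, 0 <= x i) -> abs_summable x ->
  fin_sum x F <= real_sum x.
Proof.
move=> x0 sx; rewrite (real_sumE (ge0_fin_sum_cvg x0 sx)).
apply: ub_le_sup; last by exists F.
case: sx => M xM; exists M => _ [G _ <-]; rewrite (le_trans _ (xM G))//.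
by rewrite ler_sum// => i _; rewrite ler_norm.
Qed.

Lemma real_sum_le x M : abs_summable x -> (forall F, fin_sum x F <= M) ->
  real_sum x <= M.
Proof.
move=> sx xM; apply: limr_le; first by apply/cvg_ex; eexists;
  exact: abs_summable_cvg.
by exists fset0 => // F _; exact: xM.
Qed.

Lemma real_sum_ge0 x : (forall i, 0 <= x i) -> abs_summable x ->
  0 <= real_sum x.
Proof.
by move=> x0 sx; have := ge0_fin_sum_le fset0 x0 sx;
  rewrite /fin_sum big_seq_fset0.
Qed.

Lemma ge0_abs_summable x M :
  (forall i, 0 <= x i) -> (forall F, fin_sum x F <= M) -> abs_summable x.
Proof.
move=> x0 xM; exists M => F; rewrite (le_trans _ (xM F))//.
by apply: ler_sum => i _; rewrite ger0_norm.
Qed.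

End Sums.

(** * The Cauchy-Schwarz inequality and square-summable families *)

Section CauchySchwarz.
Context {R : realType} {U : lmodType R[i]} (D : {dot U for @conjc R}).

(* 'conjc' is convertible to the conjugation of the closed field 'R[i]', so the
   generic theory of inner products applies to 'D'. *)
Local Notation DC := (D : {dot U for @Num.conj R[i]}).

Lemma dot_ge0 u : 0 <= D u u.
Proof. exact: (dnorm_ge0 DC). Qed.

Lemma dotC u v : D u v = (D v u)^*%C.
Proof. by rewrite [LHS](hermitian_subproof (s:=DC)) /= expr0 mul1r. Qed.

Lemma dotDl u v w : D (u + v) w = D u w + D v w.
Proof. exact: (linearDl DC). Qed.

Lemma dotDr u v w : D u (v + w) = D u v + D u w.
Proof. exact: (linearDr DC). Qed.

Lemma dotZl c u w : D (c *: u) w = c * D u w.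
Proof. exact: (linearZl_LR DC). Qed.

Lemma dotZr c u w : D u (c *: w) = c^*%C * D u w.
Proof. exact: (linearZr_LR DC). Qed.

(** Expands the inequality 0 <= <w, w> for w = <v, v> u - <u, v> v. *)
Lemma cauchy_schwarz u v : `|D u v| ^+ 2 <= D u u * D v v.
Proof.
have [->|v0] := eqVneq v 0.
  by rewrite !(linear0r DC) normr0 mulr0 expr0n lexx.
have d0 : 0 < D v v := neq0_dnorm_gt0 (s:=D) v v0.
set d := D v v; set c := D u v.
have /= := dot_ge0 (d *: u - c *: v).
rewrite -scaleNr !(dotDl, dotDr, dotZl, dotZr) (dotC v u) -/c -/d.
have -> : d^*%C = d by apply/conj_Creal/ger0_real/ltW.
rewrite rmorphN/=.
have -> : d * (d * D u u) + d * (- c^*%C * c) +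
  (- c * (d * c^*%C) + - c * (- c^*%C * d)) =
    d * (D u u * d - c * c^*%C) by ring.
by rewrite pmulr_rge0// subr_ge0 sqr_normc.
Qed.

Definition dnorm u : R[i] := sqrtC (D u u).

Lemma dnorm_sqr u : dnorm u ^+ 2 = D u u.
Proof. exact: sqrtCK. Qed.

Lemma dnorm_nneg u : 0 <= dnorm u.
Proof. by rewrite sqrtC_ge0 dot_ge0. Qed.

Lemma dot_le u v : `|D u v| <= dnorm u * dnorm v.
Proof.
rewrite -(@ler_pXn2r _ 2)// ?nnegrE ?mulr_ge0 ?dnorm_nneg//.
by rewrite exprMn !dnorm_sqr cauchy_schwarz.
Qed.

Lemma dnormD_le u v : dnorm (u + v) <= dnorm u + dnorm v.
Proof.
rewrite -(@ler_pXn2r _ 2)// ?nnegrE ?addr_ge0 ?dnorm_nneg//.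
rewrite dnorm_sqr sqrrD !dnorm_sqr dotDl !dotDr (dotC v u).
have -> : D u u + D u v + ((D u v)^*%C + D v v) =
  D u u + (D u v + (D u v)^*%C) + D v v by ring.
rewrite lerD2r lerD2l (le_trans (real_ler_norm _)) ?Creal_Re//.
  by rewrite addcJ; apply: realM; [exact: realn|apply/complex_realP; eexists].
rewrite (le_trans (ler_normD _ _))// normcJ mulr2n.
by rewrite lerD// dot_le.
Qed.

Lemma dnormZ_eq c u : dnorm (c *: u) = `|c| * dnorm u.
Proof.
apply/eqP; rewrite -(@eqrXn2 _ 2)// ?mulr_ge0 ?dnorm_nneg//.
by rewrite exprMn !dnorm_sqr dotZl dotZr mulrA sqr_normc.
Qed.

Lemma dnorm_eq0_eq u : dnorm u = 0 -> u = 0.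
Proof.
move=> /eqP; rewrite sqrtC_eq0 => /eqP h; apply/eqP/negPn/negP => u0.
by have := neq0_dnorm_gt0 (s:=D) u u0; rewrite h ltxx.
Qed.

End CauchySchwarz.

Section Ell2.
Context {R : realType} {I : choiceType}.
Local Notation C := R[i].

(** The squared modulus, with values in 'R' rather than in 'R[i]', so that
    suprema of sums of it exist. *)
Definition sqmod (z : C) : R := complex.Re z ^+ 2 + complex.Im z ^+ 2.

Lemma sqmod_ge0 z : 0 <= sqmod z.
Proof. by rewrite addr_ge0 ?sqr_ge0. Qed.

Lemma sqmodM z w : sqmod (z * w) = sqmod z * sqmod w.
Proof. by case: z w => [a b] [c d]; rewrite /sqmod /=; ring. Qed.

Definition l2 : {pred I -> C} := fun f => `[< abs_summable
  (fun i => sqmod (f i)) >].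

Lemma sqmodD z w : sqmod (z + w) <= 2 * (sqmod z + sqmod w).
Proof.
case: z w => [a b] [c d]; rewrite /sqmod /=.
have := sqr_ge0 (a - c); have := sqr_ge0 (b - d); rewrite !expr2; lra.
Qed.

Lemma l2_submod : submod_closed l2.
Proof.
split=> [|c f g /asboolP sf /asboolP sg].
  apply/asboolP; exists 0 => F; rewrite big1// => i _.
  by rewrite /sqmod /= expr0n addr0 normr0.
apply/asboolP.
apply: (abs_summable_dom (abs_summableZ 2 (abs_summableD
  (abs_summableZ (sqmod c) sf) sg))) => i.
rewrite ger0_norm ?sqmod_ge0//; apply: le_trans (sqmodD _ _) _.
by rewrite ler_wpM2l// lerD2r sqmodM.
Qed.

HB.instance Definition _ := GRing.isSubmodClosed.Build C _ l2 l2_submod.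

(** The Hilbert space of square-summable families on an arbitrary index type. *)
Record ell2 := Ell2 { ell2_fun :> I -> C; _ : ell2_fun \in l2 }.
HB.instance Definition _ := [isSub for ell2_fun].
HB.instance Definition _ := [Choice of ell2 by <:].
HB.instance Definition _ := [SubChoice_isSubLmodule of ell2 by <:].

End Ell2.

(** * The inner product of square-summable families *)

Section ComplexSum.
Context {R : realType} {I : choiceType}.
Local Notation C := R[i].
Implicit Types x y : I -> C.

Definition complex_summable x := abs_summable (fun i => complex.Re (x i)) /\
  abs_summable (fun i => complex.Im (x i)).

Definition complex_sum x : C :=
  real_sum (fun i => complex.Re (x i)) +i* real_sum (fun i => complex.Im (x i)).

Lemma complex_sumD x y : complex_summable x -> complex_summable y ->
  complex_sum (fun i => x i + y i) = complex_sum x + complex_sum y.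
Proof.
move=> [rx ix] [ry iy]; rewrite /complex_sum /GRing.add /= -!real_sumD//.
by congr (_ +i* _); congr real_sum; apply/funext => i;
  case: (x i) (y i) => ? ? [].
Qed.

Lemma complex_sumZ c x : complex_summable x ->
  complex_sum (fun i => c * x i) = c * complex_sum x.
Proof.
move=> [rx ix]; case: c => a b; rewrite /complex_sum /GRing.mul /=.
have e u v p q : abs_summable p -> abs_summable q ->
    u * real_sum p + v * real_sum q =
      real_sum (fun i : I => u * p i + v * q i) :> R.
  by move=> sp sq; rewrite real_sumD ?real_sumZ//; exact: abs_summableZ.
rewrite -mulNr !e//.
by congr (_ +i* _); congr real_sum; apply/funext => i; case: (x i) => c d /=;
  ring.
Qed.

End ComplexSum.

Section Ell2Hilbert.
Context {R : realType} {I : choiceType}.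
Local Notation C := R[i].
Implicit Types f g : @ell2 R I.

Lemma ell2P f : abs_summable (fun i => sqmod (f i)).
Proof. by apply/asboolP; exact: (valP f). Qed.

Lemma ell2_eqP f g : (forall i, f i = g i) -> f = g.
Proof. by move=> fg; apply/val_inj/funext. Qed.

Lemma ell2DE f g i : (f + g) i = f i + g i. Proof. by []. Qed.

Lemma ell2ZE c f i : (c *: f) i = c * f i. Proof. by []. Qed.

(** By 2 |z w| <= |z|^2 + |w|^2. *)
Lemma dot_summable f g : complex_summable (fun i => f i * (g i)^*%C).
Proof.
by split; apply: (abs_summable_dom (abs_summableD (ell2P f) (ell2P g))) => i;
  case: (f i) (g i) => [a b] [c d]; rewrite /sqmod /= ler_norml;
  have := sqr_ge0 (a - c); have := sqr_ge0 (b - d);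
  have := sqr_ge0 (a + c); have := sqr_ge0 (b + d);
  have := sqr_ge0 (a - d); have := sqr_ge0 (b - c);
  have := sqr_ge0 (a + d); have := sqr_ge0 (b + c);
  rewrite !expr2 => ? ? ? ? ? ? ? ?; apply/andP; split; lra.
Qed.

Definition ell2_dot f g : C := complex_sum (fun i => f i * (g i)^*%C).

Lemma ell2_dotDl f1 f2 g : ell2_dot (f1 + f2) g = ell2_dot f1 g + ell2_dot f2 g.
Proof.
rewrite /ell2_dot -complex_sumD; [|exact: dot_summable..].
by congr complex_sum; apply/funext => i; rewrite ell2DE mulrDl.
Qed.

Lemma ell2_dotZl c f g : ell2_dot (c *: f) g = c * ell2_dot f g.
Proof.
rewrite /ell2_dot -complex_sumZ; last exact: dot_summable.
by congr complex_sum; apply/funext => i; rewrite ell2ZE mulrA.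
Qed.

Lemma ell2_dotC f g : ell2_dot f g = (ell2_dot g f)^*%C.
Proof.
rewrite /ell2_dot /complex_sum /conjc; congr (_ +i* _).
  by congr real_sum; apply/funext => i; case: (f i) (g i) => [a b] [c d] /=;
    ring.
rewrite -mulN1r -real_sumZ; last by case: (dot_summable g f).
by congr real_sum; apply/funext => i; case: (f i) (g i) => [a b] [c d] /=; ring.
Qed.

Lemma ell2_dot_bilinear : bilinear_for
  (GRing.Scale.Law.clone _ _ ( *%R ) _) (GRing.Scale.Law.clone _ _
    (@conjc R \; *%R) _)
  ell2_dot.
Proof.
split=> [g c f1 f2|f c g1 g2] /=.
  by rewrite ell2_dotDl ell2_dotZl.
by rewrite ell2_dotC ell2_dotDl ell2_dotZl rmorphD rmorphM /=
  (ell2_dotC f g1) (ell2_dotC f g2).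
Qed.

HB.instance Definition _ := bilinear_isBilinear.Build C ell2 ell2 C _ _
  ell2_dot ell2_dot_bilinear.

Lemma ell2_dot_herm f g : ell2_dot f g = (-1) ^+ false * (ell2_dot g f)^*%C.
Proof. by rewrite expr0 mul1r -ell2_dotC. Qed.

HB.instance Definition _ := isHermitianSesquilinear.Build C ell2 false
  (@conjc R) ell2_dot ell2_dot_herm.

Lemma ell2_dotxx f : ell2_dot f f = (real_sum (fun i => sqmod (f i)))%:C.
Proof.
rewrite /ell2_dot /complex_sum; congr (_ +i* _).
  by congr real_sum; apply/funext => i; case: (f i) => a b;
    rewrite /sqmod /=; ring.
rewrite (_ : (fun _ => _) = fun i => 0 * sqmod (f i)).
  by rewrite real_sumZ ?mul0r//; exact: ell2P.
by apply/funext => i; case: (f i) => a b; rewrite /sqmod /=; ring.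
Qed.

Lemma sqmod_le_sum f i : sqmod (f i) <= real_sum (fun i => sqmod (f i)).
Proof.
apply: le_trans (ge0_fin_sum_le [fset i] _ (ell2P f));
  last by move=> ?; exact: sqmod_ge0.
by rewrite /fin_sum big_seq_fset1.
Qed.

Lemma sqmod_eq0 (z : C) : sqmod z = 0 -> z = 0.
Proof.
move=> z0; apply/eqP; rewrite -normr_eq0 -sqrf_eq0 -add_Re2_Im2.
by rewrite [X in X%:C]z0.
Qed.

Lemma ell2_dot_gt0 f : f != 0 -> 0 < ell2_dot f f.
Proof.
move=> f0; rewrite ell2_dotxx ltcR lt_def real_sum_ge0 ?andbT; last first.
- exact: ell2P.
- by move=> i; exact: sqmod_ge0.
apply: contra f0 => /eqP s0; apply/eqP/ell2_eqP => i.
by apply: sqmod_eq0; apply/eqP; rewrite eq_le sqmod_ge0 -s0 sqmod_le_sum.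
Qed.

HB.instance Definition _ := isDotProduct.Build C ell2 ell2_dot ell2_dot_gt0.

Definition ell2_dotP : {dot ell2 for @conjc R} := ell2_dot.

HB.instance Definition _ := Lmodule_isNormed.Build C (@ell2 R I)
  (dnormD_le ell2_dotP) (dnormZ_eq ell2_dotP)
  (dnorm_eq0_eq (D := ell2_dotP)).

End Ell2Hilbert.

(** * Completeness *)

Section Ell2Complete.
Context {R : realType} {I : choiceType}.
Local Notation C := R[i].
Implicit Types f g : @ell2 R I.

Lemma ell2_sqr_norm f : `|f| ^+ 2 = (real_sum (fun i => sqmod (f i)))%:C.
Proof. by rewrite [LHS]dnorm_sqr; exact: ell2_dotxx. Qed.

Lemma ell2_norm_le f (e : R) : 0 <= e ->
  (forall F : {fset I}, \sum_(i <- F) sqmod (f i) <= e ^+ 2) -> `|f| <= e%:C.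
Proof.
move=> e0 fe; rewrite -(@ler_pXn2r _ 2)// ?nnegrE ?ler0c//.
by rewrite ell2_sqr_norm -rmorphXn lecR; apply: real_sum_le;
  [exact: ell2P|exact: fe].
Qed.

Lemma ell2_norm_ge f (e : R) (F : {fset I}) :
  `|f| <= e%:C -> \sum_(i <- F) sqmod (f i) <= e ^+ 2.
Proof.
move=> fe; have e0 : 0 <= e by rewrite -ler0c (le_trans _ fe).
move: fe; rewrite -(@ler_pXn2r _ 2)// ?nnegrE ?ler0c//.
rewrite ell2_sqr_norm -rmorphXn lecR => /(le_trans _); apply.
exact: (ge0_fin_sum_le F (fun i => sqmod_ge0 (f i)) (ell2P f)).
Qed.

Lemma coord_norm_le f i : `|f i| <= `|f|.
Proof.
rewrite -(@ler_pXn2r _ 2)// ?nnegrE// ell2_sqr_norm -add_Re2_Im2 lecR.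
exact: sqmod_le_sum.
Qed.

Lemma complex_gt0P (e : C) : 0 < e -> exists2 d : R, 0 < d & e = d%:C.
Proof.
case: e => a b; rewrite ltcE /= => /andP[/eqP-> a0]; by exists a.
Qed.

Lemma norm_Re_Im_le (z : C) :
  `|complex.Re z|%:C <= `|z| /\ `|complex.Im z|%:C <= `|z|.
Proof.
split; first exact: normc_ge_Re.
rewrite -(@ler_pXn2r _ 2)// ?nnegrE ?ler0c ?normr_ge0//
  -add_Re2_Im2 -rmorphXn lecR.
by rewrite real_normK ?num_real// lerDr sqr_ge0.
Qed.

(** Used with 'p' the real or the imaginary part. *)
Lemma cauchy_ell2_coord (F : set_system (@ell2 R I)) (FF : ProperFilter F)
    (p : C -> R) :
  (forall z w, p (z - w) = p z - p w) -> (forall z, `|p z|%:C <= `|z|) ->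
  cauchy F -> forall i, cvg ((fun f : @ell2 R I => p (f i)) @ F).
Proof.
move=> pB ple /cauchyP Fc i; apply: R_complete.
apply/cauchyP => e e0.
have e0' : 0 < e%:C :> C by rewrite ltcR.
have [g gF] := Fc _ e0'; exists (p (g i)).
change (F [set f | `|p (g i) - p (f i)| < e]).
apply: filterS gF => f; rewrite -ball_normE /= => fg.
rewrite -ltcR -pB (le_lt_trans (ple _))//.
by rewrite (le_lt_trans (coord_norm_le (g - f) i)).
Qed.

(** The limit is taken coordinatewise. A bound by e on the distance to a given
    family is a bound on all finite partial sums, so it survives the limit in
    each coordinate; this gives both the square-summability of the limit and
    the convergence in norm. *)
Lemma ell2_complete (F : set_system (@ell2 R I)) :
  ProperFilter F -> cauchy F -> cvg F.
Proof.
move=> FF Fc.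
have cr := @cauchy_ell2_coord F FF (@complex.Re R) _
  (fun z => (norm_Re_Im_le z).1) Fc.
have ci := @cauchy_ell2_coord F FF (@complex.Im R) _
  (fun z => (norm_Re_Im_le z).2) Fc.
pose r i := lim ((fun f : @ell2 R I => complex.Re (f i)) @ F).
pose s i := lim ((fun f : @ell2 R I => complex.Im (f i)) @ F).
have rP i : (fun f : @ell2 R I => complex.Re (f i)) @ F --> r i by apply: cr
  => -[? ?] [? ?].
have sP i : (fun f : @ell2 R I => complex.Im (f i)) @ F --> s i by apply: ci
  => -[? ?] [? ?].
pose L i := r i +i* s i.
have key (e : R) (g : @ell2 R I) : 0 < e -> F (ball g e%:C) ->
    forall G : {fset I}, \sum_(i <- G) sqmod (L i - g i) <= e ^+ 2.
  move=> e0 Fg G.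
  have h : (fun f : @ell2 R I => \sum_(i <- G) sqmod (f i - g i)) @ F -->
      \sum_(i <- G) sqmod (L i - g i).
    elim: (G : seq I) => [|i s' IH].
      by under eq_fun do rewrite big_nil; rewrite big_nil; exact: cvg_cst.
    under eq_fun do rewrite big_cons.
    rewrite big_cons; apply: cvgD => //; rewrite /sqmod.
    have E z w : complex.Re (z - w) = complex.Re z - complex.Re w :> R.
      by case: z w => ? ? [].
    have E' z w : complex.Im (z - w) = complex.Im z - complex.Im w :> R.
      by case: z w => ? ? [].
    under eq_fun do rewrite E E'.
    rewrite E E'; apply: cvgD; rewrite !expr2; under eq_fun do rewrite expr2.
      by apply: cvgM; apply: cvgB => //; exact: cvg_cst.
    by apply: cvgM; apply: cvgB => //; exact: cvg_cst.
  apply: (cvgr_to_le h); apply: filterS Fg => f; rewrite -ball_normE /= => gf.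
  by apply: (@ell2_norm_ge (f - g)); rewrite distrC ltW.
have L2 : L \in @l2 R I.
  have [g Fg] := (cauchyP _).1 Fc 1 ltr01.
  have Lg : (L - g) \in @l2 R I.
    apply/asboolP/(ge0_abs_summable (M := 1 ^+ 2)) => [i|G];
      first exact: sqmod_ge0.
    exact: (key 1 g).
  by rewrite -(subrK (g : I -> C) L) rpredD//; exact: (valP g).
apply/cvg_ex; exists (Ell2 L2 : @ell2 R I).
apply/fcvgrPdist_lt => _ /complex_gt0P[e e0 ->].
have e20 : 0 < e / 2 by rewrite divr_gt0.
have e20' : 0 < (e / 2)%:C :> C by rewrite ltcR.
have [g Fg] := (cauchyP _).1 Fc _ e20'.
apply: filterS (Fg) => f; rewrite -ball_normE /= => gf.
rewrite [e in e%:C]splitr rmorphD (le_lt_trans (ler_distD g _ _))// ler_ltD//.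
apply: ell2_norm_le; first exact: ltW.
exact: (key _ _ e20 Fg).
Qed.

HB.instance Definition _ := Uniform_isComplete.Build (@ell2 R I) ell2_complete.

Lemma ell2_sqr_norm_dot f : `|f| ^+ 2 = ell2_dotP f f.
Proof. exact: dnorm_sqr. Qed.

HB.instance Definition _ := isHilbert.Build R (@ell2 R I) ell2_sqr_norm_dot.

End Ell2Complete.

(** * Bounded adjointable operators on a Hilbert space *)

Section HilbertBasics.
Context {R : realType} {H : hilbertType R}.
Local Notation C := R[i].
Implicit Types (x y : H) (T : H -> H).

(** Norms over 'R[i]' take values in 'R[i]'; this is the same number in 'R'. *)
Definition real_norm (V : normedModType C) (x : V) : R := complex.Re `|x|.

Lemma real_normE (V : normedModType C) (x : V) : `|x| = (real_norm x)%:C.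
Proof. by rewrite /real_norm RRe_real// ger0_real. Qed.

Lemma real_norm_ge0 (V : normedModType C) (x : V) : 0 <= real_norm x.
Proof. by rewrite -ler0c -real_normE. Qed.

Lemma hdot_le x y : `|hdot x y| <= `|x| * `|y|.
Proof.
rewrite -(@ler_pXn2r _ 2)// ?nnegrE ?mulr_ge0//.
by rewrite exprMn !sqr_norm_hdot; exact: cauchy_schwarz.
Qed.

Lemma cvg_hdotl {X : Type} {F : set_system X} {FF : Filter F} (f : X -> H) x y :
  f @ F --> x -> (fun t => hdot (f t) y) @ F --> hdot x y.
Proof.
move=> /cvgrPdist_lt fx; apply/cvgrPdist_lt => e e0.
have p0 : 0 < `|y| + 1 by rewrite ltr_wpDl.
apply: filterS (fx (e / (`|y| + 1)) _) => [t|]; last by rewrite divr_gt0.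
rewrite ltr_pdivlMr// => h; rewrite -mulN1r -[X in _ + X]dotZl scaleN1r -dotDl.
apply: le_lt_trans (hdot_le _ _) (le_lt_trans _ h).
by rewrite ler_wpM2l// lerDl.
Qed.

Lemma cvg_hdotr {X : Type} {F : set_system X} {FF : Filter F} (f : X -> H) x y :
  f @ F --> x -> (fun t => hdot y (f t)) @ F --> hdot y x.
Proof.
move=> /cvgrPdist_lt fx; apply/cvgrPdist_lt => e e0.
have p0 : 0 < `|y| + 1 by rewrite ltr_wpDl.
apply: filterS (fx (e / (`|y| + 1)) _) => [t|]; last by rewrite divr_gt0.
rewrite ltr_pdivlMr// => h; rewrite !(dotC _ y) -rmorphB/= normcJ.
rewrite -mulN1r -dotZl scaleN1r -dotDl.
apply: le_lt_trans (hdot_le _ _) (le_lt_trans _ h).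
by rewrite ler_wpM2l// lerDl.
Qed.

Lemma hdot_inj x y : (forall z, hdot z x = hdot z y) -> x = y.
Proof.
move=> e; apply/eqP; rewrite -subr_eq0 -normr_eq0 -sqrf_eq0 sqr_norm_hdot.
by rewrite dotDr e -dotDr subrr -(scale0r (0 : H)) dotZr conjc0 mul0r.
Qed.

Definition norm_bounded T := linear T /\ exists2 M : R, 0 <= M &
  forall x, `|T x| <= M%:C * `|x|.

Lemma norm_bounded_continuous T : norm_bounded T -> bounded_op T.
Proof.
move=> [lT [M M0 TM]]; split=> // x; apply/cvgrPdist_lt => e e0.
have p0 : 0 < M%:C + 1 :> C by rewrite ltr_wpDl// ler0c.
have := @cvgr_dist_lt _ _ _ (nbhs x) _ id x cvg_id (e / (M%:C + 1)).
rewrite divr_gt0// => /(_ _ isT); apply: filterS => y.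
rewrite ltr_pdivlMr// => h.
have -> : T x - T y = T (x - y).
  by have := lT (-1) y x; rewrite !scaleN1r (addrC _ x) (addrC _ (T x)) => ->.
apply: le_lt_trans (TM _) (le_lt_trans _ h).
by rewrite mulrC ler_wpM2l// lerDl.
Qed.

Definition adjoint T T' := forall x y, hdot (T x) y = hdot x (T' y).

Lemma adjoint_sym T T' : adjoint T T' -> adjoint T' T.
Proof. by move=> a x y; rewrite dotC -a -dotC. Qed.

(** Requiring an adjoint makes an involution available on these operators, see
    'bop_star'. *)
Definition adjointable : {pred H -> H} :=
  fun T => `[< norm_bounded T /\ exists2 T', norm_bounded T' & adjoint T T' >].

Lemma norm_bounded_lin c S T :
  norm_bounded S -> norm_bounded T -> norm_bounded (c *: S + T).
Proof.
move=> [lS [M M0 SM]] [lT [N N0 TN]]; split.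
  move=> a x y; rewrite -![(_ + _) _]/(c *: S _ + T _).
  by rewrite lS lT scalerDr scalerDr !scalerA (mulrC c) addrACA.
exists (real_norm (c : C^o) * M + N);
  first by rewrite addr_ge0// mulr_ge0// real_norm_ge0.
move=> x; rewrite -[(_ + _) _]/(c *: S _ + T _).
rewrite rmorphD rmorphM /= -real_normE mulrDl (le_trans (ler_normD _ _))//
  lerD//.
by rewrite normrZ -mulrA ler_wpM2l.
Qed.

Lemma adjoint_lin c S S' T T' : adjoint S S' -> adjoint T T' ->
  adjoint (c *: S + T) (c^*%C *: S' + T').
Proof.
move=> aS aT x y; rewrite -![(_ + _) _]/(_ *: _ _ + _ _).
by rewrite dotDl dotDr dotZl dotZr conjcK aS aT.
Qed.

Lemma norm_bounded0 : norm_bounded 0.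
Proof.
split; first by move=> a x y; rewrite -![0 _]/(0 : H) scaler0 addr0.
by exists 0 => // x; rewrite mul0r normr0.
Qed.

Lemma adjointable_submod : submod_closed adjointable.
Proof.
split; first (apply/asboolP; split; first exact: norm_bounded0).
  exists 0 => [|x y]; first exact: norm_bounded0.
  by rewrite -![0 _]/(0 : H) !(linear0r, linear0l).
move=> c S T /asboolP[bS [S' bS' aS]] /asboolP[bT [T' bT' aT]].
apply/asboolP; split; first exact: norm_bounded_lin.
by exists (c^*%C *: S' + T'); [exact: norm_bounded_lin|exact: adjoint_lin].
Qed.

HB.instance Definition _ := GRing.isSubmodClosed.Build C _ adjointable
  adjointable_submod.

Record bop := Bop { bop_fun :> H -> H; _ : bop_fun \in adjointable }.
HB.instance Definition _ := [isSub for bop_fun].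
HB.instance Definition _ := [Choice of bop by <:].
HB.instance Definition _ := [SubChoice_isSubLmodule of bop by <:].

End HilbertBasics.
Arguments bop {R} H.

(** * The operator norm and the completeness of the operator algebra *)

Section BopAlgebra.
Context {R : realType} {H : hilbertType R}.
Local Notation C := R[i].
Implicit Types (x y : H) (S T : bop H).

Lemma bopP T : norm_bounded T /\ exists2 T', norm_bounded T' & adjoint T T'.
Proof. by apply/asboolP; exact: (valP T). Qed.

Lemma bop_eqP S T : (forall x, S x = T x) -> S = T.
Proof. by move=> ST; apply/val_inj/funext. Qed.

Lemma mk_bop_subproof (T T' : H -> H) :
  norm_bounded T -> norm_bounded T' -> adjoint T T' -> T \in @adjointable R H.
Proof. by move=> bT bT' a; apply/asboolP; split=> //; exists T'. Qed.

Definition mk_bop (T T' : H -> H) (bT : norm_bounded T) (bT' : norm_bounded T')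
    (a : adjoint T T') : bop H := Bop (mk_bop_subproof bT bT' a).

Lemma bop_adj_ex T : exists T' : bop H, adjoint T T'.
Proof.
have [bT [T' bT' a]] := bopP T.
by exists (mk_bop bT' bT (adjoint_sym a)).
Qed.

(** Adjoints are unique, so any choice gives the same involution. *)
Definition bop_star T : bop H := projT1 (cid (bop_adj_ex T)).

Lemma bop_starP T : adjoint T (bop_star T).
Proof. by rewrite /bop_star; case: cid. Qed.

Lemma bop_star_uniq T T' : adjoint T T' -> bop_star T = T' :> (H -> H).
Proof.
move=> a; apply/funext => y; apply: hdot_inj => x.
by rewrite -a -bop_starP.
Qed.

Lemma bop_linear T : linear T.
Proof. by have [[]] := bopP T. Qed.

Lemma norm_bounded_comp (f g : H -> H) :
  norm_bounded f -> norm_bounded g -> norm_bounded (f \o g).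
Proof.
move=> [lf [M M0 fM]] [lg [N N0 gN]]; split.
  by move=> a x y /=; rewrite lg lf.
exists (M * N); first exact: mulr_ge0.
move=> x /=; rewrite (le_trans (fM _))// rmorphM /= -mulrA.
by rewrite ler_wpM2l// ler0c.
Qed.

Lemma adjoint_comp (f f' g g' : H -> H) :
  adjoint f f' -> adjoint g g' -> adjoint (f \o g) (g' \o f').
Proof. by move=> a b x y /=; rewrite a b. Qed.

Lemma bop_mul_subproof S T : (S \o T : H -> H) \in @adjointable R H.
Proof.
have [bS _] := bopP S; have [bT _] := bopP T.
have [bS' _] := bopP (bop_star S); have [bT' _] := bopP (bop_star T).
apply: (mk_bop_subproof (norm_bounded_comp bS bT) (norm_bounded_comp bT' bS')).
by apply: adjoint_comp; exact: bop_starP.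
Qed.

Definition bop_mul S T : bop H := Bop (bop_mul_subproof S T).

Definition opnorm_bounds (T : H -> H) : set R :=
  [set M | 0 <= M /\ forall x, `|T x| <= M%:C * `|x|].

(** An infimum of bounds instead of a supremum over the unit ball, so that a
    constant which bounds 'T' bounds the norm by definition. *)
Definition opnorm (T : H -> H) : R := inf (opnorm_bounds T).

Lemma opnorm_bounds_lb (T : H -> H) : has_lbound (opnorm_bounds T).
Proof. by exists 0 => M []. Qed.

Lemma opnorm_bounds_neq0 T : opnorm_bounds T !=set0.
Proof. by have [[_ [M M0 TM]] _] := bopP T; exists M. Qed.

Lemma opnorm_le T M : 0 <= M -> (forall x, `|T x| <= M%:C * `|x|) ->
  opnorm T <= M.
Proof. by move=> M0 TM; apply: ge_inf => //; exact: opnorm_bounds_lb. Qed.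

Lemma opnorm_ge0 T : 0 <= opnorm T.
Proof. by apply: lb_le_inf; [exact: opnorm_bounds_neq0|move=> M []]. Qed.

Lemma opnorm_bound T x : `|T x| <= (opnorm T)%:C * `|x|.
Proof.
have [->|x0] := eqVneq x 0.
  have [[_ [M M0 TM]] _] := bopP T.
  by have := TM 0; rewrite normr0 !mulr0.
have x1 : 0 < real_norm x by rewrite -ltcR -real_normE normr_gt0.
rewrite !real_normE -rmorphM lecR -ler_pdivrMr//.
apply: lb_le_inf; first exact: opnorm_bounds_neq0.
move=> M [M0 TM]; rewrite ler_pdivrMr// -lecR rmorphM /= -!real_normE;
  exact: TM.
Qed.

Definition bop_norm T : C := (opnorm T)%:C.

Lemma bop_normD S T : bop_norm (S + T) <= bop_norm S + bop_norm T.
Proof.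
rewrite -rmorphD lecR; apply: opnorm_le => [|x];
  first by rewrite addr_ge0// opnorm_ge0.
rewrite -[(S + T) x]/(S x + T x) rmorphD mulrDl (le_trans (ler_normD _ _))//.
by rewrite lerD// opnorm_bound.
Qed.

Lemma bop_normZ_le (c : C) T : bop_norm (c *: T) <= `|c| * bop_norm T.
Proof.
rewrite (real_normE (c : C^o)) -rmorphM lecR; apply: opnorm_le => [|x].
  by rewrite mulr_ge0 ?real_norm_ge0 ?opnorm_ge0.
rewrite -[(c *: T) x]/(c *: T x) normrZ rmorphM /= -real_normE -mulrA.
by rewrite ler_wpM2l// opnorm_bound.
Qed.

Lemma bop_normZ (c : C) T : bop_norm (c *: T) = `|c| * bop_norm T.
Proof.
apply/eqP; rewrite eq_le bop_normZ_le /=.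
have [->|c0] := eqVneq c 0; first by rewrite normr0 mul0r ler0c opnorm_ge0.
rewrite -ler_pdivlMl ?normr_gt0// -normfV.
by rewrite -[T in leLHS](scale1r) -(mulVf c0) -scalerA bop_normZ_le.
Qed.

Lemma bop_norm_eq0 T : bop_norm T = 0 -> T = 0.
Proof.
move=> [T0]; apply: bop_eqP => x; apply/eqP; rewrite -normr_le0.
by have := opnorm_bound T x; rewrite T0 mul0r.
Qed.

HB.instance Definition _ := Lmodule_isNormed.Build C (bop H)
  bop_normD bop_normZ bop_norm_eq0.

Lemma bop_normE T : `|T| = (opnorm T)%:C. Proof. by []. Qed.

(** |T' y|^2 = <T (T' y), y> <= |T| |T' y| |y|. *)
Lemma opnorm_adjoint_le T T' : adjoint T T' -> opnorm T' <= opnorm T.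
Proof.
move=> a; apply: opnorm_le => [|y]; first exact: opnorm_ge0.
have [->|y0] := eqVneq (T' y) 0;
  first by rewrite normr0 mulr_ge0// ler0c opnorm_ge0.
rewrite -(@ler_pM2r _ `|T' y|) ?normr_gt0// -expr2 sqr_norm_hdot -a.
rewrite (le_trans (real_ler_norm _))//; last first.
  rewrite (le_trans (hdot_le _ _))// mulrAC ler_wpM2r//; exact: opnorm_bound.
by rewrite a -sqr_norm_hdot rpredX// ger0_real.
Qed.

Lemma opnorm_star T : opnorm (bop_star T) = opnorm T.
Proof.
apply/eqP; rewrite eq_le; apply/andP; split; apply: opnorm_adjoint_le.
  exact: bop_starP.
by apply/adjoint_sym; exact: bop_starP.
Qed.

Lemma opnorm_mul S T : opnorm (bop_mul S T) <= opnorm S * opnorm T.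
Proof.
apply: opnorm_le => [|x]; first by rewrite mulr_ge0 ?opnorm_ge0.
rewrite (le_trans (opnorm_bound S (T x)))//
  rmorphM -mulrA ler_wpM2l ?opnorm_bound//.
by rewrite ler0c opnorm_ge0.
Qed.

(** The nontrivial inequality is |T x|^2 = <x, T* T x> <= |T* T| |x|^2. *)
Lemma opnorm_cstar T : opnorm (bop_mul (bop_star T) T) = opnorm T ^+ 2.
Proof.
apply/eqP; rewrite eq_le; apply/andP; split.
  by rewrite (le_trans (opnorm_mul _ _))// opnorm_star.
set Q := bop_mul _ _.
rewrite -(@sqr_sqrtr _ (opnorm Q)) ?opnorm_ge0//.
rewrite ler_pXn2r ?nnegrE ?opnorm_ge0 ?sqrtr_ge0//.
apply: opnorm_le => [|x]; first exact: sqrtr_ge0.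
rewrite -(@ler_pXn2r _ 2)// ?nnegrE ?mulr_ge0 ?ler0c ?sqrtr_ge0//.
rewrite exprMn -rmorphXn sqr_sqrtr ?opnorm_ge0// sqr_norm_hdot bop_starP.
rewrite (le_trans (real_ler_norm _))//.
  by rewrite -bop_starP -sqr_norm_hdot rpredX// ger0_real.
by rewrite (le_trans (hdot_le _ _))// expr2 mulrCA ler_wpM2l// (opnorm_bound Q).
Qed.

(** The pointwise limit of a Cauchy filter of operators is bounded and is a
    limit in norm. The existence of its adjoint is left to 'bop_complete', which
    applies this lemma a second time, to the filter of adjoints. *)
Lemma bop_cauchy_lim (F : set_system (bop H)) : ProperFilter F -> cauchy F ->
  exists L : H -> H, [/\ norm_bounded L,
    forall x, (fun T : bop H => T x) @ F --> L x &
    forall (e : R) T0, 0 < e -> F (ball T0 e%:C) ->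
      forall x, `|T0 x - L x| <= e%:C * `|x| ].
Proof.
move=> FF Fc.
have evle (e : R) S T x : ball S e%:C T -> `|S x - T x| <= e%:C * `|x|.
  rewrite -ball_normE /= bop_normE => ST.
  rewrite (le_trans (opnorm_bound (S - T) x))// ler_wpM2r// ltW//.
have c x : cvg ((fun T : bop H => T x) @ F).
  apply: cauchy_cvg; apply/cauchyP => _ /complex_gt0P[e e0 ->].
  have d0 : 0 < (e / (real_norm x + 1))%:C :> C.
    by rewrite ltcR divr_gt0// ltr_wpDl// real_norm_ge0.
  have [S FS] := (cauchyP _).1 Fc _ d0; exists (S x).
  change (F [set T : bop H | ball (S x) e%:C (T x)]).
  apply: filterS FS => T ST; rewrite -ball_normE /=.
  rewrite (le_lt_trans (evle _ _ _ _ ST))// real_normE -rmorphM ltcR.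
  by rewrite mulrAC ltr_pdivrMr ?ltr_wpDl ?real_norm_ge0// mulrDr mulr1 ltrDl.
pose L x := lim ((fun T : bop H => T x) @ F).
have LP x : (fun T : bop H => T x) @ F --> L x by exact: c.
have near_le (e : R) S : 0 < e -> F (ball S e%:C) ->
    forall x, `|S x - L x| <= e%:C * `|x|.
  move=> e0 FS x.
  have h : (fun T : bop H => `|S x - T x|) @ F --> `|S x - L x|.
    by apply: cvg_norm; apply: cvgB; [exact: cvg_cst|exact: LP].
  apply/ler_addgt0Pr => _ /complex_gt0P[d d0 ->].
  have d0' : 0 < d%:C :> C by rewrite ltcR.
  near F => T.
  have -> : S x - L x = (S x - T x) + (T x - L x) by rewrite addrA subrK.
  rewrite (le_trans (ler_normD _ _))// lerD//.
    by apply: evle; near: T.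
  by near: T; apply: cvgr_distC_le => //; exact: LP.
exists L; split=> //.
have ln : linear L.
  move=> a x y; apply: (@cvg_unique _ (@norm_hausdorff _ _)
    ((fun T : bop H => T (a *: x + y)) @ F)) => //; first exact: LP.
  rewrite (_ : (fun T : bop H => _) = (fun T : bop H => a *: T x + T y)).
    by apply: cvgD => //; apply: cvgZr; exact: LP.
  by apply/funext => T; rewrite bop_linear.
split=> //.
have [S FS] := (cauchyP _).1 Fc 1 ltr01.
exists (1 + opnorm S) => [|x]; first by rewrite addr_ge0// opnorm_ge0.
have := @near_le 1 S ltr01 FS x; rewrite rmorphD mulrDl => h.
rewrite -[L x](subrK (S x)) (le_trans (ler_normD _ _))// lerD ?opnorm_bound//.
by rewrite distrC.
Unshelve. all: by end_near. Qed.

Lemma bop_starB S T : bop_star (S - T) = bop_star S - bop_star T.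
Proof.
apply: val_inj; apply: bop_star_uniq => x y.
change (hdot (S x - T x) y = hdot x (bop_star S y - bop_star T y)).
by rewrite -scaleN1r -[in RHS]scaleN1r dotDl dotDr dotZl dotZr !bop_starP
  rmorphN rmorph1.
Qed.

Lemma bop_complete (F : set_system (bop H)) :
  ProperFilter F -> cauchy F -> cvg F.
Proof.
move=> FF Fc.
have [L [bL cL nL]] := bop_cauchy_lim FF Fc.
have Gc : cauchy (bop_star @ F).
  apply/cauchyP => e e0; have [S FS] := (cauchyP _).1 Fc _ e0.
  exists (bop_star S); change (F [set T | ball (bop_star S) e (bop_star T)]).
  apply: filterS FS => T; rewrite -!ball_normE /=.
  by rewrite -bop_starB !bop_normE opnorm_star.
have [L' [bL' cL' _]] := bop_cauchy_lim _ Gc.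
have a : adjoint L L'.
  move=> x y; apply: (@cvg_unique _ (@norm_hausdorff _ _)
    ((fun T : bop H => hdot (T x) y) @ F));
      first by apply: cvg_hdotl; exact: cL.
  rewrite (_ : (fun T : bop H => _) = (fun T : bop H => hdot x (bop_star T y))).
    by apply: cvg_hdotr; exact: cL'.
  by apply/funext => T; rewrite bop_starP.
apply/cvg_ex; exists (mk_bop bL bL' a).
apply/fcvgrPdist_lt => _ /complex_gt0P[e e0 ->].
have e20 : 0 < e / 2 / 2 by rewrite !divr_gt0.
have e20' : 0 < (e / 2 / 2)%:C :> C by rewrite ltcR.
have [S FS] := (cauchyP _).1 Fc _ e20'.
apply: filterS (FS) => T; rewrite -ball_normE /= => ST.
have h : `|mk_bop bL bL' a - S| <= (e / 2)%:C.
  rewrite bop_normE lecR; apply: opnorm_le => [|x];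
    first by rewrite ltW// divr_gt0.
  change (`|L x - S x| <= (e / 2)%:C * `|x|);
    rewrite distrC (le_trans (nL _ _ e20 FS x))//.
  by rewrite ler_wpM2r// lecR ler_pdivrMr// ler_peMr// ?ler1n// ltW// divr_gt0.
rewrite [e in e%:C]splitr rmorphD (le_lt_trans (ler_distD S _ _))// ler_ltD//.
rewrite (lt_le_trans ST)// lecR ler_pdivrMr// ler_peMr// ?ler1n// ltW//
  divr_gt0//.
Qed.

HB.instance Definition _ := Uniform_isComplete.Build (bop H) bop_complete.

End BopAlgebra.

(** * The C*-algebra structure of the operator algebra *)

Section BopCstar.
Context {R : realType} {H : hilbertType R}.
Local Notation C := R[i].
Implicit Types (x y : H) (S T : bop H) (c : C).

Lemma bop_mulA : associative (@bop_mul R H).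
Proof. by move=> S T U; apply: bop_eqP. Qed.

Lemma bop_mulDl : left_distributive (@bop_mul R H) +%R.
Proof. by move=> S T U; apply: bop_eqP. Qed.

Lemma bop_mulZl c S T : bop_mul (c *: S) T = c *: bop_mul S T.
Proof. exact: bop_eqP. Qed.

Lemma bopD T x y : T (x + y) = T x + T y.
Proof. by have := bop_linear T 1 x y; rewrite !scale1r. Qed.

Lemma bopZ T c x : T (c *: x) = c *: T x.
Proof.
have T0 : T 0 = 0.
  by apply: (addrI (T 0)); rewrite -bopD !addr0.
by have := bop_linear T c x 0; rewrite !addr0 T0 addr0.
Qed.

Lemma bopB T x y : T (x - y) = T x - T y.
Proof. by rewrite -(scaleN1r y) bopD bopZ scaleN1r. Qed.

Lemma bop_mulDr : right_distributive (@bop_mul R H) +%R.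
Proof. by move=> S T U; apply: bop_eqP => x; exact: bopD. Qed.

Lemma bop_mulZr c S T : bop_mul S (c *: T) = c *: bop_mul S T.
Proof. by apply: bop_eqP => x; exact: bopZ. Qed.

Lemma bop_star_eq S T : adjoint S T -> bop_star S = T.
Proof. by move=> a; apply: val_inj; exact: bop_star_uniq. Qed.

Lemma bop_starK : involutive (@bop_star R H).
Proof. by move=> T; apply: bop_star_eq; apply: adjoint_sym;
  exact: bop_starP. Qed.

Lemma bop_starD : {morph @bop_star R H : S T / S + T}.
Proof.
move=> S T; apply: bop_star_eq => x y.
by rewrite [LHS]dotDl [RHS]dotDr !bop_starP.
Qed.

Lemma bop_starZ c T : bop_star (c *: T) = conjc c *: bop_star T.
Proof.
apply: bop_star_eq => x y.
by rewrite [LHS]dotZl [RHS]dotZr conjcK bop_starP.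
Qed.

Lemma bop_starM S T : bop_star (bop_mul S T) =
  bop_mul (bop_star T) (bop_star S).
Proof.
by apply: bop_star_eq; apply: adjoint_comp; exact: bop_starP.
Qed.

Lemma bop_norm_mul S T : `|bop_mul S T| <= `|S| * `|T|.
Proof. by rewrite !bop_normE -rmorphM lecR opnorm_mul. Qed.

Lemma bop_cstar T : `|bop_mul (bop_star T) T| = `|T| ^+ 2.
Proof. by rewrite !bop_normE opnorm_cstar rmorphXn. Qed.

HB.instance Definition _ := isCStarAlgebra.Build R (bop H)
  bop_mulA bop_mulDl bop_mulDr bop_mulZl bop_mulZr
  bop_starK bop_starD bop_starZ bop_starM bop_norm_mul bop_cstar.

End BopCstar.

(** * Exel-Laca families from nested projections *)

(** For the matrix [j <= i] the relations of the Exel-Laca algebra say that the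
    projections q_i increase with i and that p_j = q_j - q_(j-1). Indeed a
    product of q_x over X and of 1 - q_y over Y, both nonempty, is
    q_m (1 - q_M) with m = min X and M = max Y, which telescopes to the sum of
    p_j over M < j <= m; if X or Y is empty, infinitely many coefficients are
    nonzero and there is no relation. *)
Section ElRelations.
Context {R : realType} {A : cstarAlgType R} (s : int -> A).
Local Notation C := R[i].

Let q i := star (s i) ** s i.
Let p i := s i ** star (s i).

Lemma cmul0x (x : A) : 0 ** x = 0.
Proof. by have := cmulZl 0 (0 : A) x; rewrite !scale0r. Qed.

Lemma cmulx0 (x : A) : x ** 0 = 0.
Proof. by have := cmulZr 0 x (0 : A); rewrite !scale0r. Qed.

Lemma cmulNl (x y : A) : (- x) ** y = - (x ** y).
Proof. by rewrite -scaleN1r cmulZl scaleN1r. Qed.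

Lemma cmulNr (x y : A) : x ** (- y) = - (x ** y).
Proof. by rewrite -scaleN1r cmulZr scaleN1r. Qed.

Lemma prod_le_coef (X : seq int) (j : int) :
  \prod_(x <- X) (j <= x)%R%:R = (all (fun x => j <= x) X)%:R :> C.
Proof.
elim: X => [|x X IH]; first by rewrite big_nil.
by rewrite big_cons IH -natrM mulnb.
Qed.

Lemma prod_gt_coef (Y : seq int) (j : int) :
  \prod_(y <- Y) (1 - (j <= y)%R%:R) = (all (fun y => y < j) Y)%:R :> C.
Proof.
elim: Y => [|y Y IH]; first by rewrite big_nil.
rewrite big_cons IH /= ltNge; case: (j <= y) => /=.
  by rewrite mulr1n subrr mul0r.
by rewrite mulr0n subr0 mul1r.
Qed.

Hypothesis s_partial : forall i, partial_isometry (s i).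
Hypothesis q_mull : forall i j, i <= j -> q i ** q j = q i.
Hypothesis q_mulr : forall i j, i <= j -> q j ** q i = q i.
Hypothesis p_q : forall j, p j = q j - q (j - 1).

Lemma prod_q (x : int) (X : seq int) : exists m : int,
  (forall j : int, all (fun y => j <= y) (x :: X) = (j <= m)) /\
  \big[@umul R A/@uone R A]_(y <- x :: X) uinj (q y) = uinj (q m).
Proof.
elim: X x => [|y X IH] x.
  exists x; split=> [j|]; first by rewrite /= andbT.
  rewrite big_seq1_id /umul /uinj /uone /=.
  by rewrite cmulx0 scale0r scale1r !add0r mul0r.
have [m [mP mE]] := IH y.
exists (Num.min x m); split=> [j|].
  by rewrite -[LHS]/((j <= x) && all _ (y :: X)) mP le_min.
rewrite big_cons mE /umul /uinj /= !scale0r !addr0 mulr0.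
by case: leP => [/q_mull|/ltW/q_mulr] ->.
Qed.

Lemma prod_1q (x : int) (X : seq int) : exists m : int,
  (forall j : int, all (fun y => y < j) (x :: X) = (m < j)) /\
  \big[@umul R A/@uone R A]_(y <- x :: X) (uone A - uinj (q y)) =
    uone A - uinj (q m).
Proof.
elim: X x => [|y X IH] x.
  exists x; split=> [j|]; first by rewrite /= andbT.
  rewrite big_seq1_id /umul /uinj /uone.
  by congr (_, _) => /=; rewrite ?cmulx0 ?scaler0 ?scale1r ?add0r ?mulr1.
have [m [mP mE]] := IH y.
exists (Num.max x m); split=> [j|].
  by rewrite -[LHS]/((x < j) && all _ (y :: X)) mP gt_max.
rewrite big_cons mE /umul /uinj /=; congr (_, _) => /=.
  rewrite !subr0 !scale1r !add0r cmulNl cmulNr opprK.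
  have [xm|/ltW mx] := leP x m; last by rewrite q_mulr// subrr add0r.
  by rewrite q_mull// addrAC subrr add0r.
by rewrite !subr0 mul1r.
Qed.

Lemma sum_p (M : int) (n : nat) :
  \sum_(j <- [seq M + 1 + k%:Z | k <- iota 0 n]) p j = q (M + n%:Z) - q M.
Proof.
rewrite big_map; elim: n => [|n IH]; first by rewrite big_nil addr0 subrr.
rewrite -addn1 iotaD big_cat IH big_seq1 p_q add0n.
have -> : M + 1 + n%:Z - 1 = M + n%:Z by lia.
have -> : M + 1 + n%:Z = M + (n + 1)%:Z by lia.
by rewrite [LHS]addrC addrA subrK.
Qed.

(** Rules out the relations in which one of the two finite sets is empty. *)
Lemma infinite_ray (c : int -> C) (f : nat -> int) : injective f ->
  (forall k, c (f k) != 0) -> ~ finite_set [set j | c j != 0].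
Proof.
move=> fI cf fin; apply: infinite_nat.
have := finite_preimage (fun x y _ _ => @fI x y) fin.
by apply: sub_finite_set => k _ /=; exact: cf.
Qed.

Lemma el_relations_of_nested : el_relations (fun i j : int => j <= i) s.
Proof.
split.
- exact: s_partial.
- by move=> i j; case: (leP i j) => [|/ltW] h; rewrite -/(q i) -/(q j)
    (q_mull h) (q_mulr h).
- move=> i j ij; rewrite -/(p i) -/(p j) !p_q !(cmulDl, cmulDr, cmulNl, cmulNr).
  case: (ltgtP i j) ij => // h _.
    rewrite !q_mull; [|lia..]; by rewrite !subrr.
  rewrite !q_mulr; [|lia..]; by rewrite subrr.
- move=> i j; rewrite -/(q i) -/(p j) p_q cmulDr cmulNr.
  case: (leP j i) => h; first by rewrite !q_mulr ?scale1r//; lia.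
  by rewrite !q_mull ?subrr ?scale0r//; lia.
move=> X Y fin.
have coefE j : el_coef R (fun i j : int => j <= i) X Y j =
    (all (fun x => j <= x) X && all (fun y => y < j) Y)%:R.
  by rewrite /el_coef prod_le_coef prod_gt_coef -natrM mulnb.
have [X0|[x [X' XE]]] : (X : seq int) = [::] \/ exists x X', (X : seq int) =
  x :: X'.
- by case: (X : seq int) => [|x X']; [left|right; exists x, X'].
- exfalso; case: (Y : seq int) coefE => [|y Y'] coefE.
    apply: (infinite_ray (f := fun k : nat => k%:Z) _ _ fin) => [k k' []//|k].
    by rewrite coefE X0 oner_eq0.
  have [m [mP _]] := prod_1q y Y'.
  apply: (infinite_ray (f := fun k : nat => m + 1 + k%:Z) _ _ fin) => [k k'|k].
    by move=> /addrI [].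
  rewrite coefE X0 mP /= (_ : _ < _) ?oner_eq0//; lia.
have [m [mP mE]] := prod_q x X'.
have [Y0|[y [Y' YE]]] : (Y : seq int) = [::] \/ exists y Y', (Y : seq int) =
  y :: Y'.
- by case: (Y : seq int) => [|y Y']; [left|right; exists y, Y'].
- exfalso.
  apply: (infinite_ray (f := fun k : nat => m - k%:Z) _ _ fin) => [k k'|k].
    by move=> /addrI /oppr_inj [].
  rewrite coefE Y0 XE mP /= andbT (_ : _ <= _) ?oner_eq0//; lia.
have [M [MP ME]] := prod_1q y Y'.
(* The support of the coefficients is the interval M < j <= m, listed by 'r'. *)
pose n := if M <= m then `|(m - M)%R|%N else 0%N.
pose r := [seq M + 1 + k%:Z | k <- iota 0 n].
have rP j : (j \in r) = (j <= m) && (M < j).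
  apply/mapP/andP => [[k] | [jm Mj]].
    by rewrite mem_iota add0n /n; case: ifP => // Mm /andP[_ kn] ->; split; lia.
  exists `|(j - (M + 1))%R|%N; last by lia.
  by rewrite mem_iota add0n /n; case: ifP => ?; lia.
have ru : uniq r by rewrite map_inj_uniq ?iota_uniq// => k k' /addrI [].
rewrite [in LHS]XE [in LHS]YE mE ME.
rewrite (@fsbigE _ _ _ _ setT r) => // [|j _]; last first.
  by rewrite coefE XE YE mP MP rP => /negbTE ->; rewrite scale0r.
rewrite (eq_bigl xpredT) => [|j]; last by rewrite in_setT.
rewrite big_seq (eq_bigr p) => [|j jr]; last first.
  by rewrite coefE XE YE mP MP -rP jr scale1r.
rewrite -big_seq sum_p /n /umul /uinj /=; congr (_, _); last by rewrite mul0r.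
rewrite scale0r addr0 subr0 scale1r add0r cmulNr addrC.
case: (leP M m) => h.
  by rewrite (q_mulr h); congr (q _ - _); lia.
by rewrite (q_mull (ltW h)) subrr addr0 subrr.
Qed.

End ElRelations.

(** * The canonical orthonormal basis *)

Section Delta.
Context {R : realType} {I : choiceType}.
Local Notation C := R[i].
Local Notation H := (@ell2 R I).
Implicit Types (f g : H) (a b x : I).

Lemma delta_l2 a : (fun x => (x == a)%:R : C) \in @l2 R I.
Proof.
apply/asboolP; apply: (ge0_abs_summable (M := 1)) => [i|F];
  first exact: sqmod_ge0.
have n0 (i : I) : i != a -> sqmod ((i == a)%:R : C) = 0.
  by move=> /negbTE ->; rewrite /sqmod /= expr0n addr0.
have [aF|aF] := boolP (a \in F).
  rewrite /fin_sum (big_fsetD1 a)//= eqxx big1_seq => [|i].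
    by rewrite /sqmod /= expr1n expr0n !addr0.
  by rewrite !inE => /andP[_ /andP[/n0]].
rewrite /fin_sum big1_seq ?ler01// => i iF; apply: n0.
by apply: contraNneq aF => <-.
Qed.

Definition delta a : H := Ell2 (delta_l2 a).

Lemma deltaE a x : delta a x = (x == a)%:R. Proof. by []. Qed.

Lemma delta_sumE (r : seq I) f x :
  (\sum_(i <- r) f i *: delta i) x = \sum_(i <- r) f i * (x == i)%:R.
Proof. by elim: r => [|i r IH]; rewrite ?big_nil// !big_cons -IH. Qed.

(** The squared distance from f to its restriction to F is the sum of |f i|^2
    outside F, which is small when F is large. *)
Lemma partial_sum_cvg f :
  (fun F : {fset I} => \sum_(i <- F) f i *: delta i) @ totally --> f.
Proof.
apply/cvgrPdist_le => _ /complex_gt0P[e e0 ->].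
have e20 : 0 < e ^+ 2 by rewrite exprn_gt0.
have near_e := @cvgr_dist_le _ _ _ _ _ _ _ (abs_summable_cvg (ell2P f)) _ e20.
apply: filterS (near_e _) => F hF; apply: ell2_norm_le; first exact: ltW.
move=> G.
have E i : sqmod ((f - \sum_(j <- F) f j *: delta j) i) =
    if i \notin F then sqmod (f i) else 0.
  change (sqmod (f i - (\sum_(j <- F) f j *: delta j) i) = if i \notin F then
    sqmod (f i) else 0).
  have [iF|iF] := boolP (i \in F).
    rewrite delta_sumE (big_fsetD1 i)//= big1_seq => [|j].
      by rewrite eqxx mulr1 addr0 subrr /sqmod /= expr0n addr0.
    rewrite !inE => /andP[_ /andP[ji _]].
    by rewrite eq_sym (negbTE ji) mulr0.
  rewrite delta_sumE big1_seq ?subr0// => j /andP[_ jF].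
  rewrite (_ : i == j = false) ?mulr0//.
  by apply: contraNF iF => /eqP ->.
under eq_bigr do rewrite E.
rewrite -big_mkcond /=.
apply: le_trans hF; rewrite ler_normr; apply/orP; left.
rewrite lerBrDl.
apply: le_trans (ge0_fin_sum_le (F `|` G) (fun i => sqmod_ge0 (f i)) (ell2P f)).
rewrite /fin_sum (big_fsetID _ (mem F) (F `|` G)) /=.
have -> : [fset i | i in F `|` G & i \in F] = F.
  by apply/fsetP => i; rewrite !inE /=; case: (i \in F); rewrite ?andbT ?andbF.
rewrite lerD2l big_fset_condE (_ : [fset i in F `|` G | i \notin F] =
  [fset i in G | i \notin F])//.
by apply/fsetP => i; rewrite !inE /=; case: (i \in F); rewrite ?andbT ?andbF.
Qed.

Lemma delta_dense (S : set H) : closed S -> S 0 ->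
  (forall (c : C) f g, S f -> S g -> S (c *: f + g)) ->
  (forall a, S (delta a)) -> S = setT.
Proof.
move=> cS S0 lS dS; apply/seteqP; split=> // f _.
have near_S : @totally I [set F : {fset I} | S (\sum_(i <- F) f i *: delta i)].
  apply: (@filterE _ totally) => F /=; elim: (F : seq I) => [|i r IH];
    first by rewrite big_nil.
  by rewrite big_cons; exact: lS.
exact: (closed_cvg _ cS near_S _ (@partial_sum_cvg f)).
Qed.

Lemma closed_ker (V : normedModType C) (u : H -> V) : continuous u ->
  closed [set f | u f = 0].
Proof.
move=> cu; apply: (@preimage_closed _ _ u [set 0]);
  first by move=> ? _; exact: cu.
exact/accessible_closed_set1/hausdorff_accessible/norm_hausdorff.
Qed.

Lemma delta_ext (V : normedModType C) (u : H -> V) : linear u -> continuous u ->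
  (forall a, u (delta a) = 0) -> forall f, u f = 0.
Proof.
move=> lu cu du f.
have u0 : u 0 = 0 by have := lu (-1) 0 0; rewrite scaler0 addr0 scaleN1r addNr.
suff /(congr1 (fun S : set H => S f)) : [set f | u f = 0] = setT.
  by move=> /= ->.
apply: delta_dense => //; first exact: closed_ker.
by move=> c g h /= ug uh; rewrite lu ug uh scaler0 addr0.
Qed.

Lemma hdot_continuousl (y : H) : continuous (fun x : H => hdot x y).
Proof. by move=> x; exact: (@cvg_hdotl _ _ _ (nbhs x) _ id x y cvg_id). Qed.

Lemma continuous_sub (u v : H -> C^o) : continuous u -> continuous v ->
  continuous (fun k => u k - v k : C^o).
Proof. by move=> cu cv k; exact: (cvgB (cu k) (cv k)). Qed.

(** Adjointness need only be tested on the basis, in each argument in turn. *)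
Lemma delta_adjoint (T T' : H -> H) : norm_bounded T -> norm_bounded T' ->
  (forall a b, hdot (T (delta a)) (delta b) = hdot (delta a) (T' (delta b))) ->
  adjoint T T'.
Proof.
move=> bT bT' TT'.
have [lT cT] := norm_bounded_continuous bT;
  have [lT' cT'] := norm_bounded_continuous bT'.
have step b f : hdot (T f) (delta b) = hdot f (T' (delta b)).
  apply/eqP; rewrite -subr_eq0; apply/eqP.
  pose u f := hdot (T f) (delta b) - hdot f (T' (delta b)) : C^o.
  apply: (@delta_ext _ u) => [c g h|g|a].
  - by rewrite /u lT !dotDl !dotZl scalerBr addrACA opprD.
  - move: g; apply: continuous_sub; last exact: hdot_continuousl.
    by move=> g; exact: (@cvg_hdotl _ _ _ (nbhs g) _ T _ _ (cT g)).
  - by rewrite /u TT' subrr.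
move=> f g; rewrite dotC [RHS]dotC; congr (_^*%C).
apply/eqP; rewrite -subr_eq0; apply/eqP.
pose u g := hdot g (T f) - hdot (T' g) f : C^o.
apply: (@delta_ext _ u) => [c h k|h|a].
- by rewrite /u lT' !dotDl !dotZl scalerBr addrACA opprD.
- move: h; apply: continuous_sub; first exact: hdot_continuousl.
  by move=> h; exact: (@cvg_hdotl _ _ _ (nbhs h) _ T' _ _ (cT' h)).
- by rewrite /u dotC step -dotC subrr.
Qed.

Lemma hdot_deltar f b : hdot f (delta b) = f b.
Proof.
pose u f := hdot f (delta b) - f b : C^o.
apply/eqP; rewrite -subr_eq0; apply/eqP.
apply: (@delta_ext _ u) => [c h k|h|a].
- by rewrite /u dotDl dotZl ell2DE ell2ZE scalerBr addrACA opprD.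
- move: h; apply: continuous_sub; first exact: hdot_continuousl.
  move=> h; apply/(@cvgrPdist_lt _ C^o _ (nbhs h)) => e e0;
    have near_e := @cvgr_dist_lt _ _ _ (nbhs h) _ id h cvg_id e e0.
  apply: (@filterS _ (nbhs h) _ _ _ _ (near_e _)) => k hk.
  exact: le_lt_trans (coord_norm_le (h - k) b) hk.
rewrite /u deltaE; apply/eqP; rewrite subr_eq0; apply/eqP.
have st G (x : I -> R) l : (forall F : {fset I}, G `<=` F -> fin_sum x F = l) ->
    real_sum x = l.
  move=> h; apply: real_sumE; apply: cvg_near_cst.
  by exists G.
rewrite -[LHS]/(complex_sum (fun x => delta a x * (delta b x)^*%C))
  /complex_sum.
have e x : delta a x * (delta b x)^*%C = ((x == a) && (x == b))%:R.
  by rewrite !deltaE conjc_nat -natrM mulnb.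
rewrite (@st [fset b] _ ((b == a)%:R)) => [|F]; last first.
  rewrite fsub1set => bF; rewrite /fin_sum (big_fsetD1 b)//= big1_seq => [|i].
    by rewrite e eqxx andbT addr0; case: (b == a).
  rewrite !inE => /andP[_ /andP[ib _]].
  by rewrite e (negbTE ib) andbF.
rewrite (@st fset0 _ 0) => [|F _]; last first.
  by rewrite /fin_sum big1_seq// => i _; rewrite e; case: (_ && _).
by case: (b == a).
Qed.

End Delta.

(** * Weighted partial permutations *)

Section PartialPermutations.
Context {R : realType} {I : choiceType}.
Local Notation C := R[i].
Local Notation H := (@ell2 R I).
Implicit Types (f g : H) (a b x y : I).

(** The data of an operator f |-> (x |-> w x * f (s x)): on the support of the
    weight 'w' the map 's' is injective, and the inverse data describe the
    adjoint. Weights are real, so no conjugate appears. *)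
Record partial_perm := PartialPerm {
  pp_weight : I -> R; pp_map : I -> I; pp_weight_inv : I -> R;
    pp_map_inv : I -> I;
  pp_weight_le : forall x, `|pp_weight x| <= 1;
  pp_mapK : forall x, pp_weight x != 0 -> pp_map_inv (pp_map x) = x /\
    pp_weight_inv (pp_map x) = pp_weight x;
  pp_map_invK : forall y, pp_weight_inv y != 0 -> pp_map (pp_map_inv y) =
    y /\ pp_weight (pp_map_inv y) = pp_weight_inv y }.

Implicit Types P Q : partial_perm.

Lemma pp_weight_inv_le P y : `|pp_weight_inv P y| <= 1.
Proof.
have [->|y0] := eqVneq (pp_weight_inv P y) 0; first by rewrite normr0 ler01.
by have [_ <-] := pp_map_invK y0; exact: pp_weight_le.
Qed.

Definition pp_inv P : partial_perm := PartialPerm (pp_weight_inv_le P)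
  (@pp_map_invK P) (@pp_mapK P).

Lemma sqmod_real (r : R) : sqmod (r%:C) = r ^+ 2.
Proof. by rewrite /sqmod /= expr0n addr0. Qed.

(** 'pp_map' is injective on the support of the weight, so a finite part of the
    left-hand side is dominated by a finite part of the sum for f. *)
Lemma weighted_perm_sum_le P f (F : {fset I}) :
  fin_sum (fun x => sqmod ((pp_weight P x)%:C * f (pp_map P x))) F <=
    real_sum (fun x => sqmod (f x)).
Proof.
pose G := [fset x in F | pp_weight P x != 0].
have inj : {in G &, injective (pp_map P)}.
  move=> x y; rewrite !inE /= => /andP[_ /pp_mapK[e _]]
    /andP[_ /pp_mapK[e' _]] xy.
  by rewrite -e xy e'.
apply: (@le_trans _ _ (\sum_(x <- G) sqmod (f (pp_map P x)))).
  rewrite -big_fset_condE big_mkcond; apply: ler_sum => x _.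
  rewrite sqmodM sqmod_real; case: eqVneq => [->|_] /=.
    by rewrite expr0n mul0r.
  rewrite ler_piMl ?sqmod_ge0// -real_normK ?num_real//.
  by rewrite exprn_ile1 ?pp_weight_le.
rewrite -(big_imfset _ imfset_key (fun y => sqmod (f y)) inj) /=.
exact: (ge0_fin_sum_le _ (fun i => sqmod_ge0 (f i)) (ell2P f)).
Qed.

Lemma weighted_perm_l2 P f :
  (fun x => (pp_weight P x)%:C * f (pp_map P x)) \in @l2 R I.
Proof.
by apply/asboolP; apply: (ge0_abs_summable _ (@weighted_perm_sum_le P f)) =>
  i; exact: sqmod_ge0.
Qed.

Definition weighted_perm_fun P f : H := Ell2 (weighted_perm_l2 P f).

Lemma weighted_perm_bounded P : norm_bounded (weighted_perm_fun P).
Proof.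
split=> [c f g|].
  apply: ell2_eqP => x.
  change ((pp_weight P x)%:C * (c * f (pp_map P x) + g (pp_map P x)) =
    c * ((pp_weight P x)%:C * f (pp_map P x)) + (pp_weight P x)%:C * g
      (pp_map P x)).
  by rewrite mulrDr mulrCA.
exists 1 => // f; rewrite mul1r.
rewrite -(@ler_pXn2r _ 2)// ?nnegrE// !ell2_sqr_norm lecR.
by apply: real_sum_le; [exact: ell2P|exact: weighted_perm_sum_le].
Qed.

Lemma weighted_perm_adjoint P :
  adjoint (weighted_perm_fun P) (weighted_perm_fun (pp_inv P)).
Proof.
apply: delta_adjoint; [exact: weighted_perm_bounded..|move=> a b].
rewrite hdot_deltar dotC hdot_deltar.
rewrite -[LHS]/((pp_weight P b)%:C * (pp_map P b == a)%:R).
rewrite -[X in conjc X]/((pp_weight_inv P a)%:C * (pp_map_inv P a == b)%:R).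
have -> : ((pp_weight_inv P a)%:C * (pp_map_inv P a == b)%:R)^*%C =
    (pp_weight_inv P a)%:C * (pp_map_inv P a == b)%:R :> C.
  by rewrite -(rmorph_nat (real_complex R)) -rmorphM conjc_real.
have [b0|b0] := eqVneq (pp_weight P b) 0;
  have [a0|a0] := eqVneq (pp_weight_inv P a) 0.
- by rewrite a0 b0 !mul0r.
- case: (eqVneq (pp_map_inv P a) b) => [ab|_]; last by rewrite b0 mul0r mulr0.
  have [_] := pp_map_invK a0; rewrite ab b0 => e.
  by rewrite -e eqxx in a0.
- case: (eqVneq (pp_map P b) a) => [ab|_]; last by rewrite a0 mul0r mulr0.
  have [_] := pp_mapK b0; rewrite ab a0 => e.
  by rewrite -e eqxx in b0.
- have [e1 e2] := pp_mapK b0; have [e3 e4] := pp_map_invK a0.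
  case: (eqVneq (pp_map P b) a) => [ab|ab]; first by rewrite -ab e1 eqxx e2.
  by case: (eqVneq (pp_map_inv P a) b) => [ba|]; rewrite ?mulr0//;
    rewrite -ba e3 eqxx in ab.
Qed.

Definition weighted_perm P : bop H :=
  mk_bop (weighted_perm_bounded P) (weighted_perm_bounded (pp_inv P))
    (weighted_perm_adjoint P).

Lemma weighted_perm_star P : star (weighted_perm P) = weighted_perm (pp_inv P).
Proof. exact/bop_star_eq/weighted_perm_adjoint. Qed.

Lemma weighted_perm_norm P f : `|weighted_perm P f| <= `|f|.
Proof.
rewrite -(@ler_pXn2r _ 2)// ?nnegrE// !ell2_sqr_norm lecR.
by apply: real_sum_le; [exact: ell2P|exact: weighted_perm_sum_le].
Qed.

Lemma weighted_perm_commute P Q :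
  (forall x, pp_map P (pp_map Q x) = pp_map Q (pp_map P x)) ->
  (forall x, pp_weight P (pp_map Q x) = pp_weight P x) ->
    (forall x, pp_weight Q (pp_map P x) = pp_weight Q x) ->
  weighted_perm P ** weighted_perm Q = weighted_perm Q ** weighted_perm P.
Proof.
move=> c wP wQ; apply: bop_eqP => f; apply: ell2_eqP => x.
change ((pp_weight P x)%:C * ((pp_weight Q (pp_map P x))%:C * f
  (pp_map Q (pp_map P x))) =
  (pp_weight Q x)%:C * ((pp_weight P (pp_map Q x))%:C * f
    (pp_map P (pp_map Q x)))).
by rewrite wP wQ c mulrCA.
Qed.

End PartialPermutations.
Arguments partial_perm R I : clear implicits.

(** * Configurations of letters and local operators *)

(** The pair (m, c) at level k consists of the multiplicity m of the letter k in
    a non-increasing path and of an auxiliary bit c, on which the generators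
    will not act. *)
Definition label := (nat * bool)%type.

Definition finsupp_config : {pred int -> label} := fun x =>
  `[< exists N : nat, forall k : int, (N < `|k|)%N -> x k = (0%N, false) >].

(** These index an orthonormal basis of a tensor product over the levels, the
    label (0, false) standing for the reference vector. *)
Record config := Config { config_fun :> int -> label;
  _ : config_fun \in finsupp_config }.
HB.instance Definition _ := [isSub for config_fun].
HB.instance Definition _ := [Choice of config by <:].

Lemma config_eqP (x y : config) : (forall k, x k = y k) -> x = y.
Proof. by move=> xy; apply/val_inj/funext. Qed.

Lemma config_finsupp (x : config) : exists N : nat,
  forall k : int, (N < `|k|)%N -> x k = (0%N, false).
Proof. by apply/asboolP; exact: (valP x). Qed.

Lemma upd_subproof (x : config) (k : int) (v : label) :
  (fun l => if l == k then v else x l) \in finsupp_config.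
Proof.
have [N xN] := config_finsupp x; apply/asboolP; exists (maxn N `|k|%N) => l.
rewrite gtn_max => /andP[Nl kl]; case: eqVneq => [lk|_]; last exact: xN.
by rewrite lk ltnn in kl.
Qed.

Definition upd x k v : config := Config (upd_subproof x k v).

Lemma updE x k v l : upd x k v l = if l == k then v else x l. Proof. by []. Qed.

Lemma upd_id (x : config) k : upd x k (x k) = x.
Proof. by apply: config_eqP => l; rewrite updE; case: eqVneq => // ->. Qed.

Lemma upd_upd x k v w : upd (upd x k v) k w = upd x k w.
Proof. by apply: config_eqP => l; rewrite !updE; case: eqVneq. Qed.

Lemma upd_same x k v : upd x k v k = v.
Proof. by rewrite updE eqxx. Qed.

Lemma updC x k l v w : k != l -> upd (upd x k v) l w = upd (upd x l w) k v.
Proof.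
move=> kl; apply: config_eqP => i; rewrite !updE.
by have [->|//] := eqVneq i l; rewrite eq_sym (negbTE kl).
Qed.

(** The condition for prepending the letter 'j' to a non-increasing path. *)
Definition clear_above (j : int) (x : config) : bool :=
  `[< forall k, j < k -> (x k).1 = 0%N >].

Lemma clear_above_upd (j : int) (x : config) (k : int) (v : label) :
  (j < k -> v.1 = (x k).1) -> clear_above j (upd x k v) = clear_above j x.
Proof.
move=> h; apply/asboolP/asboolP => z l jl.
  by have := z l jl; rewrite updE; case: eqVneq => [lk|//]; rewrite h -?lk.
by rewrite updE; case: eqVneq => [lk|_]; [rewrite h -?lk// z -?lk|exact: z].
Qed.

Lemma clear_above_upd_le (j : int) (x : config) (k : int) (v : label) :
  k <= j -> clear_above j (upd x k v) = clear_above j x.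
Proof. by move=> kj; apply: clear_above_upd; lia. Qed.

Lemma clear_above_pred (j : int) (x : config) :
  clear_above (j - 1) x = clear_above j x && ((x j).1 == 0%N).
Proof.
apply/asboolP/andP => [z|[/asboolP z /eqP xj] k jk].
  by split; [apply/asboolP => k jk; apply: z; lia|apply/eqP/z; lia].
by have [->//|kj] := eqVneq k j; apply: z; lia.
Qed.

Lemma clear_above_mono (i j : int) (x : config) :
  i <= j -> clear_above i x -> clear_above j x.
Proof. by move=> ij /asboolP z; apply/asboolP => k jk; apply: z; lia. Qed.

Section Local.
Context {R : realType}.
Local Notation C := R[i].

Record label_perm := LabelPerm {
  lp_weight : label -> R; lp_map : label -> label;
    lp_weight_inv : label -> R; lp_map_inv : label -> label;
  lp_weight_le : forall v, `|lp_weight v| <= 1;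
  lp_mapK : forall v, lp_weight v != 0 -> lp_map_inv (lp_map v) = v /\
    lp_weight_inv (lp_map v) = lp_weight v;
  lp_map_invK : forall v, lp_weight_inv v != 0 -> lp_map (lp_map_inv v) =
    v /\ lp_weight (lp_map_inv v) = lp_weight_inv v }.

(** The operator given by 'L' at level 'k'. With the guard 'b' it is first cut
    down to the configurations with no letter above 'k'. *)
Section LocalPerm.
Variables (b : bool) (k : int) (L : label_perm).

Let w (a : label -> R) (x : config) : R :=
  if b ==> clear_above k x then a (x k) else 0.
Let s (t : label -> label) (x : config) : config := upd x k (t (x k)).

Lemma local_perm_le x : `|w (lp_weight L) x| <= 1.
Proof. by rewrite /w; case: ifP => _; rewrite ?lp_weight_le// normr0 ler01. Qed.

Lemma local_permK x : w (lp_weight L) x != 0 ->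
  s (lp_map_inv L) (s (lp_map L) x) = x /\
    w (lp_weight_inv L) (s (lp_map L) x) = w (lp_weight L) x.
Proof.
rewrite /w /s clear_above_upd_le// upd_same; case: ifP => [_|];
  last by rewrite eqxx.
by move=> /lp_mapK[-> ->]; rewrite upd_upd upd_id.
Qed.

Lemma local_perm_invK x : w (lp_weight_inv L) x != 0 ->
  s (lp_map L) (s (lp_map_inv L) x) = x /\
    w (lp_weight L) (s (lp_map_inv L) x) = w (lp_weight_inv L) x.
Proof.
rewrite /w /s clear_above_upd_le// upd_same; case: ifP => [_|];
  last by rewrite eqxx.
by move=> /lp_map_invK[-> ->]; rewrite upd_upd upd_id.
Qed.

Definition local_perm : partial_perm R config := PartialPerm local_perm_le
  local_permK local_perm_invK.

End LocalPerm.

Notation H := (@ell2 R config).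

Definition level_op b k L : bop H := weighted_perm (local_perm b k L).

Lemma level_opE b k L (f : H) x : level_op b k L f x =
  (if b ==> clear_above k x then lp_weight L (x k) else 0)%:C * f
    (upd x k (lp_map L (x k))).
Proof. by []. Qed.

Lemma level_op_starE b k L (f : H) x : (star (level_op b k L)) f x =
  (if b ==> clear_above k x then lp_weight_inv L (x k) else 0)%:C * f
    (upd x k (lp_map_inv L (x k))).
Proof. by rewrite weighted_perm_star. Qed.

(** A guard at level k only looks at the multiplicities above k; hence the
    condition on an operator acting there. *)
Lemma level_op_commute (b : bool) (k l : int) (K L : label_perm) :
  k != l -> (b -> k < l -> forall v, (lp_map L v).1 = v.1) ->
  level_op b k K ** level_op false l L = level_op false l L ** level_op b k K.
Proof.
move=> kl h; have lk : l == k = false by rewrite eq_sym (negbTE kl).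
apply: weighted_perm_commute => x /=; rewrite ?lk ?(negbTE kl)//.
  by rewrite [RHS]updC// eq_sym lk.
by case: b h => //= h; rewrite clear_above_upd// => kl'; rewrite h.
Qed.

Lemma level_op_commute_same (b : bool) (k : int) (K L : label_perm) :
  (forall v, lp_map K (lp_map L v) = lp_map L (lp_map K v)) ->
  (forall v, lp_weight K (lp_map L v) = lp_weight K v) ->
    (forall v, lp_weight L (lp_map K v) = lp_weight L v) ->
  level_op b k K ** level_op false k L = level_op false k L ** level_op b k K.
Proof.
move=> c hK hL; apply: weighted_perm_commute => x /=;
  rewrite ?eqxx ?upd_upd ?c//.
by rewrite clear_above_upd_le ?hK.
Qed.

End Local.

(** * The operators at a single level *)

Section Operators.
Context {R : realType}.
Local Notation C := R[i].
Local Notation H := (@ell2 R config).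
Local Notation B := (bop H).
Implicit Types (f : H) (x : config) (j k l : int) (S T : B).

Lemma bop_addE S T f x : (S + T) f x = S f x + T f x. Proof. by []. Qed.
Lemma bop_oppE T f x : (- T) f x = - T f x. Proof. by []. Qed.
Lemma bop_mulE S T f : (S ** T) f = S (T f). Proof. by []. Qed.

Lemma bop_ext S T : (forall f x, S f x = T f x) -> S = T.
Proof. by move=> ST; apply: bop_eqP => f; apply: ell2_eqP. Qed.

Section Invol.
Variables (w : label -> R) (t : label -> label).
Hypothesis w1 : forall v, `|w v| <= 1.
Hypothesis wt : forall v, w v != 0 -> t (t v) = v /\ w (t v) = w v.
(** Label operators with real weights that are their own inverse give
    self-adjoint operators. *)
Definition involutive_label : label_perm := LabelPerm w1 wt wt.
End Invol.

Lemma involutive_star b k w t w1 wt :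
  star (level_op b k (@involutive_label w t w1 wt)) =
    level_op b k (@involutive_label w t w1 wt).
Proof. by apply: bop_ext => f x; rewrite level_op_starE. Qed.

(** As an operator on functions this reads f |-> (m |-> f (m - 1)): it sends the
    basis vector at m to the one at m + 1. *)
Definition raise_label : @label_perm R.
Proof.
refine (@LabelPerm R (fun v => (0 < v.1)%N%:R) (fun v => (v.1.-1, v.2))
  (fun=> 1) (fun v => (v.1.+1, v.2)) _ _ _).
- abstract by case=> -[|m] c; rewrite ?normr0 ?normr1 ?ler01.
- abstract by case=> -[|m] c //=; rewrite ?eqxx.
- abstract by case=> m c.
Defined.

Definition diag_label (w : label -> R) (w1 : forall v, `|w v| <= 1) :
  @label_perm R :=
  @involutive_label w id w1 (fun v _ => conj erefl erefl).

Lemma bool_weight_le (b : bool) : `|b%:R : R| <= 1.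
Proof. by case: b; rewrite ?normr0 ?normr1 ?ler01. Qed.

Lemma one_weight_le (v : label) : `|1 : R| <= 1.
Proof. by rewrite normr1. Qed.

Lemma sign_bit_weight_le (v : label) : `|(-1) ^+ v.2 : R| <= 1.
Proof. by rewrite normr_sign. Qed.

Definition sign_mult_weight (v : label) : R :=
  if v.1 == 0%N then 1 else if v.1 == 1%N then -1 else 0.

Lemma sign_mult_weight_le v : `|sign_mult_weight v| <= 1.
Proof. by rewrite /sign_mult_weight; do 2?case: ifP => _;
  rewrite ?normrN ?normr0 ?normr1 ?ler01. Qed.

Definition inv_sqrt2 : R := Num.sqrt (2^-1).

Lemma inv_sqrt2_sqr : inv_sqrt2 * inv_sqrt2 = 2^-1.
Proof. by rewrite -expr2 sqr_sqrtr// invr_ge0. Qed.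

Lemma inv_sqrt2_le : `|inv_sqrt2| <= 1.
Proof.
rewrite ger0_norm ?sqrtr_ge0// -sqrtr1 ler_sqrt// invf_le1//.
by rewrite ler1n.
Qed.

Definition hadamard_diag_weight (v : label) : R :=
  if v == (0%N, false) then inv_sqrt2
  else if v == (1%N, true) then - inv_sqrt2 else 1.

Definition hadamard_swap_weight (v : label) : R :=
  if (v == (0%N, false)) || (v == (1%N, true)) then inv_sqrt2 else 0.

Lemma hadamard_diag_weight_le v : `|hadamard_diag_weight v| <= 1.
Proof. by rewrite /hadamard_diag_weight; do 2?case: ifP => _;
  rewrite ?normrN ?inv_sqrt2_le ?normr1. Qed.

Lemma hadamard_swap_weight_le v : `|hadamard_swap_weight v| <= 1.
Proof. by rewrite /hadamard_swap_weight; case: ifP => _;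
  rewrite ?inv_sqrt2_le ?normr0 ?ler01. Qed.

Definition toggle_both (v : label) : label := ((1 - v.1)%N, ~~ v.2).
Definition toggle_mult (v : label) : label := ((1 - v.1)%N, v.2).
Definition toggle_bit (v : label) : label := (v.1, ~~ v.2).

Lemma toggle_bothP v : hadamard_swap_weight v != 0 ->
  toggle_both (toggle_both v) = v /\
    hadamard_swap_weight (toggle_both v) = hadamard_swap_weight v.
Proof. by rewrite /hadamard_swap_weight; case: v => -[|[|m]] [] //=;
  rewrite ?eqxx. Qed.

Lemma toggle_multP (v : label) : (v.1 <= 1)%N%:R != 0 :> R ->
  toggle_mult (toggle_mult v) = v /\
    (((toggle_mult v).1 <= 1)%N%:R = (v.1 <= 1)%N%:R :> R).
Proof. by case: v => -[|[|m]] c //=; rewrite ?eqxx. Qed.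

Lemma toggle_bitP (v : label) :
  1 != 0 :> R -> toggle_bit (toggle_bit v) = v /\ 1 = 1 :> R.
Proof. by case: v => m c; rewrite /toggle_bit /= negbK. Qed.

Definition id_label := diag_label one_weight_le.
Definition sign_mult_label := diag_label sign_mult_weight_le.
Definition sign_bit_label := diag_label sign_bit_weight_le.
Definition flip_mult_label := involutive_label
  (fun v => bool_weight_le (v.1 <= 1)%N) toggle_multP.
Definition flip_bit_label := involutive_label one_weight_le toggle_bitP.
Definition hadamard_diag_label := diag_label hadamard_diag_weight_le.
Definition hadamard_swap_label := involutive_label hadamard_swap_weight_le
  toggle_bothP.
Definition vac_label := diag_label (fun v => bool_weight_le
  (v == (0%N, false))).

(** The rotation by which the basis label (0, false) comes to represent the
    maximally entangled vector ((0, false) + (1, true)) / sqrt 2; it exchanges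
    that description with the one in terms of multiplicities and bits. *)
Definition hadamard k : B :=
  level_op false k hadamard_diag_label + level_op false k hadamard_swap_label.

(** The partial isometry that adds one letter 'j' in front of a path without
    letters above 'j', and its initial projection. *)
Definition prepend j : B := level_op true j raise_label.
Definition clear_proj j : B := level_op true j id_label.

(** The Pauli operators on the multiplicities 0 and 1, extended by 0 to the
    other multiplicities, and the Pauli operators on the bit. *)
Definition flip_mult k : B := level_op false k flip_mult_label.
Definition sign_mult k : B := level_op false k sign_mult_label.
Definition flip_bit k : B := level_op false k flip_bit_label.
Definition sign_bit k : B := level_op false k sign_bit_label.
Definition vac_proj k : B := level_op false k vac_label.

Definition idop : B := level_op false 0 id_label.

Lemma idopE f : idop f = f.
Proof. by apply: ell2_eqP => x; rewrite level_opE /= upd_id mul1r. Qed.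

Lemma idop_mull T : idop ** T = T.
Proof. by apply: bop_eqP => f; rewrite bop_mulE idopE. Qed.

Lemma idop_mulr T : T ** idop = T.
Proof. by apply: bop_eqP => f; rewrite bop_mulE idopE. Qed.

Lemma hadamard_star k : star (hadamard k) = hadamard k.
Proof. by rewrite /hadamard starD !involutive_star. Qed.

Lemma hadamard_sqr k : hadamard k ** hadamard k = idop.
Proof.
apply: bop_ext => f x; rewrite idopE bop_mulE /hadamard !bop_addE !level_opE
  !bop_addE !level_opE.
rewrite /= !eqxx !upd_upd !upd_id /hadamard_diag_weight /hadamard_swap_weight.
have inv_sqrt2_mul : inv_sqrt2%:C * inv_sqrt2%:C = (2^-1)%:C :> C by rewrite
  -rmorphM inv_sqrt2_sqr.
have hh : (2^-1)%:C + (2^-1)%:C = 1 :> C.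
  by rewrite -rmorphD (_ : 2^-1 + 2^-1 = 1 :> R)//; lra.
case E : (x k) => [[|[|m]] []] //=;
  rewrite ?mul1r ?mul0r ?addr0 ?mulr0 ?addr0//.
- have -> : upd x k (toggle_both (toggle_both (0%N, false))) = x by rewrite
  -[RHS](upd_id x k) E.
  transitivity ((inv_sqrt2%:C * inv_sqrt2%:C + inv_sqrt2%:C * inv_sqrt2%:C) *
    f x); last by rewrite inv_sqrt2_mul hh mul1r.
  by rewrite rmorphN; ring.
- have -> : upd x k (toggle_both (toggle_both (1%N, true))) = x by rewrite
  -[RHS](upd_id x k) E.
  transitivity ((inv_sqrt2%:C * inv_sqrt2%:C + inv_sqrt2%:C * inv_sqrt2%:C) *
    f x); last by rewrite inv_sqrt2_mul hh mul1r.
  by rewrite rmorphN; ring.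
Qed.

Lemma prepend_starE j f x : (star (prepend j)) f x =
  ((clear_above j x)%:R : R)%:C * f (upd x j ((x j).1.+1, (x j).2)).
Proof. by rewrite level_op_starE /=; case: ifP. Qed.

Lemma prependE j f x : prepend j f x =
  ((clear_above j x && (0 < (x j).1)%N)%:R : R)%:C * f
    (upd x j ((x j).1.-1, (x j).2)).
Proof. by rewrite level_opE /=; case: (clear_above j x). Qed.

Lemma clear_projE j f x : clear_proj j f x =
  ((clear_above j x)%:R : R)%:C * f x.
Proof. by rewrite level_opE /= upd_id; case: (clear_above j x). Qed.

Lemma prepend_star_prepend j : star (prepend j) ** prepend j = clear_proj j.
Proof.
apply: bop_ext => f x; rewrite bop_mulE prepend_starE prependE clear_projE
  clear_above_upd_le//= eqxx upd_upd /=.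
by rewrite -surjective_pairing upd_id andbT; case: clear_above;
  rewrite ?mul0r// mul1r.
Qed.

Lemma prepend_prepend_star j :
  prepend j ** star (prepend j) = clear_proj j - clear_proj (j - 1).
Proof.
apply: bop_ext => f x; rewrite bop_mulE bop_addE bop_oppE prependE
  prepend_starE !clear_projE.
rewrite clear_above_upd_le//= eqxx upd_upd /= clear_above_pred.
case: (clear_above j x); rewrite ?mul0r ?subrr//=.
case E : (x j) => [[|m] c] /=; rewrite ?mul0r ?subr0 ?mul1r ?subrr//.
by rewrite -E upd_id.
Qed.

Lemma clear_proj_mull i j : i <= j ->
  clear_proj i ** clear_proj j = clear_proj i.
Proof.
move=> ij; apply: bop_ext => f x; rewrite bop_mulE !clear_projE.
case: (boolP (clear_above i x)) => [/(clear_above_mono ij) ->|_];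
  last by rewrite !mul0r.
by rewrite !mul1r.
Qed.

Lemma clear_proj_mulr i j : i <= j ->
  clear_proj j ** clear_proj i = clear_proj i.
Proof.
move=> ij; apply: bop_ext => f x; rewrite bop_mulE !clear_projE.
case: (boolP (clear_above i x)) => [/(clear_above_mono ij) ->|_];
  last by rewrite !(mul0r, mulr0).
by rewrite !mul1r.
Qed.

Lemma prepend_partial_isometry j :
  prepend j ** star (prepend j) ** prepend j = prepend j.
Proof.
rewrite -cmulA prepend_star_prepend; apply: bop_ext => f x.
rewrite bop_mulE !prependE clear_projE clear_above_upd_le//;
  case: (clear_above j x) => /=; rewrite ?mul0r//.
by rewrite mul1r.
Qed.

(** Puts the flip at level k, cut down to a corner, into the algebra generated
    by the 'prepend j'; 'sign_mult_corner' does the same for the sign. *)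
Lemma flip_mult_corner k : flip_mult k ** clear_proj k =
  prepend k ** clear_proj (k - 1) + clear_proj (k - 1) ** star (prepend k).
Proof.
apply: bop_ext => f x.
rewrite bop_addE !bop_mulE prependE !clear_projE prepend_starE level_opE
  clear_projE /=.
rewrite !clear_above_pred !clear_above_upd_le//= !eqxx /toggle_mult /=.
case: (clear_above k x) => /=; rewrite ?mul0r ?mulr0 ?addr0//.
by case E : (x k) => [[|[|m]] c] /=; rewrite ?mul0r ?mul1r ?mulr0 ?add0r ?addr0.
Qed.

Lemma sign_mult_corner k : sign_mult k ** clear_proj k =
  clear_proj (k - 1) - prepend k ** clear_proj (k - 1) ** star (prepend k).
Proof.
apply: bop_ext => f x.
rewrite bop_addE bop_oppE !bop_mulE prependE !clear_projE prepend_starE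
  level_opE clear_projE /= upd_id.
rewrite !clear_above_pred !clear_above_upd_le//= !eqxx upd_upd
  /sign_mult_weight /=.
case: (clear_above k x) => /=; rewrite ?mul0r ?mulr0 ?oppr0 ?addr0//.
case E : (x k) => [[|[|m]] c] /=;
  rewrite ?mul0r ?mul1r ?mulr0 ?oppr0 ?add0r ?addr0//.
by rewrite -E upd_id rmorphN rmorph1 mulN1r.
Qed.

Lemma flip_sign_bit_anticommute k :
  flip_bit k ** sign_bit k = - (sign_bit k ** flip_bit k).
Proof.
apply: bop_ext => f x; rewrite bop_oppE !bop_mulE !level_opE /= !upd_id eqxx /=.
by rewrite signrN rmorphN mulNr mulrN !mul1r.
Qed.

Lemma flip_bit_sqr k : flip_bit k ** flip_bit k = idop.
Proof.
apply: bop_ext => f x; rewrite idopE bop_mulE !level_opE /= eqxx upd_upd.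
by rewrite /toggle_bit /= negbK -surjective_pairing upd_id !mul1r.
Qed.

Lemma sign_bit_sqr k : sign_bit k ** sign_bit k = idop.
Proof.
apply: bop_ext => f x; rewrite idopE bop_mulE !level_opE /= !eqxx !upd_id.
by case: (x k).2; rewrite ?expr0 ?expr1 ?rmorphN ?rmorph1; ring.
Qed.

(** On the maximally entangled vector, acting on the multiplicity and acting on
    the bit have the same effect; likewise for 'sign_mult_bit_vac'. *)
Lemma flip_mult_bit_vac k : (flip_mult k - flip_bit k) **
  (hadamard k ** vac_proj k) = 0.
Proof.
apply: bop_ext => f x; rewrite bop_mulE bop_addE bop_oppE !level_opE.
rewrite !bop_mulE /hadamard !bop_addE !level_opE /= !eqxx !upd_upd
  /hadamard_diag_weight /hadamard_swap_weight /toggle_mult /toggle_bit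
    /toggle_both /=.
by case E : (x k) => [[|[|m]] []] /=;
  rewrite ?(mul0r, mul1r, mulr0, addr0, add0r, subr0, oppr0)
  ?subrr.
Qed.

Lemma sign_mult_bit_vac k : (sign_mult k - sign_bit k) **
  (hadamard k ** vac_proj k) = 0.
Proof.
apply: bop_ext => f x; rewrite bop_mulE bop_addE bop_oppE !level_opE.
rewrite !bop_mulE /hadamard !bop_addE !level_opE /= !eqxx !upd_upd !upd_id
  /hadamard_diag_weight /hadamard_swap_weight /sign_mult_weight /toggle_both /=.
by case E : (x k) => [[|[|m]] []] /=;
  rewrite ?(mul0r, mul1r, mulr0, addr0, add0r, subr0, oppr0)
  ?subrr.
Qed.

End Operators.

(** * The Exel-Laca family on the tensor product *)

Section Frames.
Context {R : realType}.
Local Notation C := R[i].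
Local Notation H := (@ell2 R config).
Local Notation B := (bop H).
Implicit Types (S T : B) (n m i : nat) (j k l : int).

Local Notation one := (@idop R).

Definition level (n : nat) : int := - n%:Z.

(** Rotates the levels 0, -1, ..., -(n-1). Rotating all the levels down to -oo
    would change the reference vector of an infinite tensor product, and is not
    an operator on the space; but an operator at level j is insensitive to
    the levels below j, so that a finite rotation suffices for it. *)
Fixpoint frame n : B :=
  if n is m.+1 then frame m ** hadamard (level m) else one.

Lemma idop_star : star one = one.
Proof. exact: involutive_star. Qed.

Lemma frame0 : frame 0 = one. Proof. by []. Qed.

Lemma frameS n : frame n.+1 = frame n ** hadamard (level n). Proof. by []. Qed.

Lemma frame_star n : star (frame n.+1) = hadamard (level n) ** star (frame n).
Proof. by rewrite frameS starM hadamard_star. Qed.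

Lemma frame_unitary n : frame n ** star (frame n) = one /\
  star (frame n) ** frame n = one.
Proof.
elim: n => [|n [IH1 IH2]]; first by rewrite frame0 idop_star idop_mull.
rewrite frame_star frameS; split.
  by rewrite cmulA -(cmulA (frame n)) hadamard_sqr idop_mulr.
by rewrite cmulA -(cmulA _ (star (frame n))) IH2 idop_mulr hadamard_sqr.
Qed.

Definition framed n T : B := frame n ** T ** star (frame n).

Lemma framedM n S T : framed n S ** framed n T = framed n (S ** T).
Proof.
by rewrite /framed !cmulA -(cmulA (frame n ** S)) (frame_unitary n).2 idop_mulr.
Qed.

Lemma framed_star n T : star (framed n T) = framed n (star T).
Proof. by rewrite /framed !starM starK cmulA. Qed.

Lemma framedD n S T : framed n (S + T) = framed n S + framed n T.
Proof. by rewrite /framed cmulDr cmulDl. Qed.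

Lemma framedN n T : framed n (- T) = - framed n T.
Proof. by rewrite /framed cmulNr cmulNl. Qed.

Lemma framed_idop n : framed n one = one.
Proof. by rewrite /framed idop_mulr (frame_unitary n).1. Qed.

Lemma framed_step n T : hadamard (level n) ** T = T ** hadamard (level n) ->
  framed n.+1 T = framed n T.
Proof.
move=> c; rewrite /framed frame_star frameS -!cmulA; congr (_ ** _);
  rewrite !cmulA.
by rewrite c -(cmulA T) hadamard_sqr idop_mulr.
Qed.

Lemma framed_stable m n T : (m <= n)%N ->
  (forall i, (m <= i)%N -> hadamard (level i) ** T = T ** hadamard (level i)) ->
  framed n T = framed m T.
Proof.
move=> mn c; rewrite -(subnK mn); elim: (n - m)%N => [//|d IH].
by rewrite addSn framed_step// c// leq_addl.
Qed.

Lemma hadamard_commute k l (b : bool) (L : @label_perm R) : k != l ->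
  (b -> l < k -> False) -> hadamard k ** level_op b l L =
    level_op b l L ** hadamard k.
Proof.
move=> kl h; rewrite /hadamard cmulDl cmulDr.
by congr (_ + _); rewrite level_op_commute// 1?eq_sym// => bb lk;
  exfalso; exact: (h bb lk).
Qed.

(** A frame only rotates levels k <= 0. At the positive levels the reference
    vector must have multiplicity 0: with the entangled vector there, the
    product of the projections on multiplicity 0 at all the levels above j would
    vanish. *)
Definition gen j : B := framed `|j|.+1 (prepend j).

(** The frame is irrelevant as soon as it reaches below the level. *)
Lemma gen_framed j n : level n < j -> gen j = framed n (prepend j).
Proof.
move=> nj.
have c i : level i < j -> hadamard (level i) ** prepend j =
  prepend j ** hadamard (level i) :> B.
  move=> ij; apply: hadamard_commute.
    by rewrite /level in ij *; lia.
  by move=> _ ji; rewrite /level in ij ji; lia.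
have [h|h] := leqP n `|j|.+1; rewrite /gen.
  by rewrite (framed_stable h)// => i ni; apply: c; rewrite /level in nj *; lia.
rewrite (framed_stable (ltnW h))// => i ni; apply: c; rewrite /level in nj *;
  lia.
Qed.

Lemma level_below j k : exists n, level n < j /\ level n < k.
Proof. by exists (`|j| + `|k|).+1; rewrite /level; split; lia. Qed.

Lemma gen_star_gen j n : level n < j ->
  star (gen j) ** gen j = framed n (clear_proj j).
Proof. by move=> nj; rewrite (gen_framed nj) framed_star framedM
  prepend_star_prepend. Qed.

(** Each relation between the nested projections involves finitely many
    generators, hence can be checked in a common frame, where these are
    monomial operators. *)
Lemma gen_relations : el_relations (fun i j : int => j <= i) gen.
Proof.
apply: el_relations_of_nested => [i|i j ij|i j ij|j].
- have [n [ni _]] := level_below i i.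
  by rewrite /partial_isometry (gen_framed ni) framed_star 2!framedM
    prepend_partial_isometry.
- have [n [ni nj]] := level_below i j.
  by rewrite !(gen_star_gen (n := n))// framedM clear_proj_mull.
- have [n [ni nj]] := level_below i j.
  by rewrite !(gen_star_gen (n := n))// framedM clear_proj_mulr.
- have [n [nj nj']] := level_below j (j - 1).
  by rewrite !(gen_star_gen (n := n))//
    (gen_framed nj) framed_star framedM prepend_prepend_star framedD framedN.
Qed.

(** The Pauli operators of level -i in the rotated frame, and the projection on
    the reference vector of that level. *)
Definition fflip_mult i := framed i.+1 (flip_mult (level i)).
Definition fsign_mult i := framed i.+1 (sign_mult (level i)).
Definition fflip_bit i := framed i.+1 (flip_bit (level i)).
Definition fsign_bit i := framed i.+1 (sign_bit (level i)).
Definition fvac i := vac_proj (R := R) (level i).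

Lemma framed_level_op i n (L : @label_perm R) : (i < n)%N ->
  framed n (level_op false (level i) L) =
    framed i.+1 (level_op false (level i) L).
Proof.
move=> n_i; apply: framed_stable => // m im; apply: hadamard_commute => //.
by rewrite /level; lia.
Qed.

Lemma frame_vac n i : (n <= i)%N ->
  star (frame n) ** fvac i = fvac i ** star (frame n).
Proof.
elim: n => [|n IH] ni; first by rewrite frame0 idop_star idop_mull idop_mulr.
rewrite frame_star -cmulA (IH (ltnW ni)) !cmulA hadamard_commute// /level; lia.
Qed.

(** In the frame of level -i the reference vector is maximally entangled. *)
Lemma fflip_vac i : (fflip_mult i - fflip_bit i) ** fvac i = 0.
Proof.
rewrite /fflip_mult /fflip_bit -framedN -framedD /framed frame_star -!cmulA
  frame_vac//.
rewrite (cmulA (hadamard _) (fvac i)) (cmulA _ (hadamard _ ** fvac i))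
  flip_mult_bit_vac.
by rewrite cmul0x !cmulx0.
Qed.

Lemma fsign_vac i : (fsign_mult i - fsign_bit i) ** fvac i = 0.
Proof.
rewrite /fsign_mult /fsign_bit -framedN -framedD /framed frame_star -!cmulA
  frame_vac//.
rewrite (cmulA (hadamard _) (fvac i)) (cmulA _ (hadamard _ ** fvac i))
  sign_mult_bit_vac.
by rewrite cmul0x !cmulx0.
Qed.

Lemma fbit_anticommute i : fflip_bit i ** fsign_bit i =
  - (fsign_bit i ** fflip_bit i).
Proof. by rewrite /fflip_bit /fsign_bit !framedM flip_sign_bit_anticommute
  framedN. Qed.

Lemma fflip_bit_sqr i : fflip_bit i ** fflip_bit i = one.
Proof. by rewrite /fflip_bit framedM flip_bit_sqr framed_idop. Qed.

Lemma fsign_bit_sqr i : fsign_bit i ** fsign_bit i = one.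
Proof. by rewrite /fsign_bit framedM sign_bit_sqr framed_idop. Qed.

Lemma fflip_bit_star i : star (fflip_bit i) = fflip_bit i.
Proof. by rewrite /fflip_bit framed_star involutive_star. Qed.

Lemma fsign_bit_star i : star (fsign_bit i) = fsign_bit i.
Proof. by rewrite /fsign_bit framed_star involutive_star. Qed.

Lemma prepend_flip_bit k j :
  prepend j ** flip_bit k = flip_bit k ** prepend (R := R) j.
Proof.
have [->|jk] := eqVneq j k; last exact: level_op_commute.
by apply: level_op_commute_same => -[m c].
Qed.

Lemma prepend_sign_bit k j :
  prepend j ** sign_bit k = sign_bit k ** prepend (R := R) j.
Proof.
have [->|jk] := eqVneq j k; last exact: level_op_commute.
by apply: level_op_commute_same => -[m c].
Qed.

Lemma fflip_bit_gen i j : fflip_bit i ** gen j = gen j ** fflip_bit i.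
Proof.
have nj : level (maxn i `|j|).+1 < j by rewrite /level; lia.
rewrite (gen_framed nj) /fflip_bit -(framed_level_op (n := (maxn i `|j|).+1))
  ?ltnS ?leq_maxl//.
by rewrite !framedM [in RHS]prepend_flip_bit.
Qed.

Lemma fsign_bit_gen i j : fsign_bit i ** gen j = gen j ** fsign_bit i.
Proof.
have nj : level (maxn i `|j|).+1 < j by rewrite /level; lia.
rewrite (gen_framed nj) /fsign_bit -(framed_level_op (n := (maxn i `|j|).+1))
  ?ltnS ?leq_maxl//.
by rewrite !framedM [in RHS]prepend_sign_bit.
Qed.

Let q j := star (gen j) ** gen j.

Lemma fflip_mult_corner i : fflip_mult i ** q (level i) =
  gen (level i) ** q (level i - 1) + q (level i - 1) ** star (gen (level i)).
Proof.
have n1 : level i.+2 < level i by rewrite /level; lia.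
have n2 : level i.+2 < level i - 1 by rewrite /level; lia.
rewrite /q (gen_star_gen n1) (gen_star_gen n2) (gen_framed n1) framed_star
  2!framedM -framedD -flip_mult_corner.
by rewrite /fflip_mult -(framed_level_op (n := i.+2))// framedM.
Qed.

Lemma fsign_mult_corner i : fsign_mult i ** q (level i) =
  q (level i - 1) - gen (level i) ** q (level i - 1) ** star (gen (level i)).
Proof.
have n1 : level i.+2 < level i by rewrite /level; lia.
have n2 : level i.+2 < level i - 1 by rewrite /level; lia.
rewrite /q (gen_star_gen n1) (gen_star_gen n2) (gen_framed n1) framed_star
  2!framedM -framedN -framedD -sign_mult_corner.
by rewrite /fsign_mult -(framed_level_op (n := i.+2))// framedM.
Qed.

Lemma framed_level_op_gen i j (L : @label_perm R) : level i < j ->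
  framed i.+1 (level_op false (level i) L) ** gen j =
    gen j ** framed i.+1 (level_op false (level i) L).
Proof.
move=> ij; have nj : level i.+1 < j by rewrite /level in ij *; lia.
rewrite (gen_framed nj) !framedM [in RHS]level_op_commute// ?gt_eqF//.
by move=> _ h; rewrite /level in h ij; lia.
Qed.

End Frames.

(** * Strong approximation at deep levels *)

Section Isometries.
Context {R : realType}.
Local Notation C := R[i].
Local Notation H := (@ell2 R config).
Local Notation B := (bop H).
Implicit Types (v f : H) (T : B).

Lemma isometry_norm T v : star T ** T = @idop R -> `|T v| = `|v|.
Proof.
move=> TT; apply/eqP; rewrite -(@eqrXn2 _ 2)// !sqr_norm_hdot bop_starP.
by rewrite -[bop_star T (T v)]/((star T ** T) v) TT idopE.
Qed.

Lemma frame_starK n v : frame n (star (frame n) v) = v.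
Proof.
have := congr1 (fun T : B => T v) (frame_unitary (R := R) n).1.
by rewrite idopE.
Qed.

Lemma star_frameK n v : star (frame n) (frame n v) = v.
Proof.
have := congr1 (fun T : B => T v) (frame_unitary (R := R) n).2.
by rewrite idopE.
Qed.

Lemma framed_frame n T v : framed n T (frame n v) = frame n (T v).
Proof. exact: (congr1 (fun w => frame n (T w)) (star_frameK n v)). Qed.

Lemma framed_norm n (P : partial_perm R config) v :
  `|framed n (weighted_perm P) v| <= `|v|.
Proof.
rewrite -[framed n (weighted_perm P) v]/(frame n
  (weighted_perm P (star (frame n) v))).
rewrite isometry_norm ?(frame_unitary n).2//
  (le_trans (weighted_perm_norm _ _))//.
by rewrite isometry_norm// starK (frame_unitary n).1.
Qed.

Lemma vac_delta (x : config) : exists N, forall i, (N <= i)%N ->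
  fvac (R := R) i (delta x) = delta x.
Proof.
have [N xN] := config_finsupp x; exists N.+1 => i Ni; apply: ell2_eqP => y.
rewrite level_opE /= upd_id; have [->|xy] := eqVneq y x; last by rewrite mulr0.
by rewrite xN ?eqxx ?mul1r// /level; lia.
Qed.

(** A basis vector is the reference vector at all but finitely many levels. *)
Lemma vac_approx v (e : C) : 0 < e -> exists N, forall i, (N <= i)%N ->
  `|v - fvac i v| <= e.
Proof.
move=> e0; have e20 : 0 < e / 2 by rewrite divr_gt0.
have near_v := @cvgr_dist_le _ _ _ _ _ _ _ (@partial_sum_cvg R config v) _ e20.
have [F /= vF] := @filter_ex _ _ _ _ (near_v _).
set w : H := \sum_(x <- F) v x *: delta x in vF.
have [N wN] : exists N, forall i, (N <= i)%N -> fvac i w = w.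
  rewrite /w; elim: (F : seq config) => [|x r [N IH]].
    exists 0%N => i _; rewrite big_nil.
    by have := bopZ (fvac i) 0 (0 : H); rewrite !scale0r.
  have [N' xN'] := vac_delta x; exists (maxn N N') => i; rewrite geq_max.
  by move=> /andP[Ni N'i]; rewrite !big_cons bopD bopZ xN'// IH.
exists N => i Ni.
have -> : v - fvac i v = (v - w) + fvac i (w - v).
  by rewrite bopB (wN _ Ni) addrA subrK.
rewrite [e]splitr (le_trans (ler_normD _ _))// lerD//.
by rewrite (le_trans (weighted_perm_norm _ _))// distrC.
Qed.

(** Contractions that agree on the reference vector of level -i differ little on
    a given vector when i is large. *)
Lemma diff_small (S T : nat -> B) v (e : C) : 0 < e ->
  (forall i w, `|S i w| <= `|w|) -> (forall i w, `|T i w| <= `|w|) ->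
  (forall i, (S i - T i) ** fvac i = 0) ->
  exists N, forall i, (N <= i)%N -> `|S i v - T i v| <= e.
Proof.
move=> e0 S1 T1 ST; have e20 : 0 < e / 2 by rewrite divr_gt0.
have [N vN] := vac_approx v e20; exists N => i Ni.
have -> : S i v - T i v = S i (v - fvac i v) - T i (v - fvac i v).
  have := congr1 (fun V : B => V v) (ST i).
  rewrite -[LHS]/(S i (fvac i v) - T i (fvac i v)) -[RHS]/(0 : H) => /eqP.
  rewrite subr_eq0 => /eqP h.
  by rewrite !bopB h opprB addrA subrK.
rewrite [e]splitr (le_trans (ler_normB _ _))// lerD//.
  by rewrite (le_trans (S1 _ _))// vN.
by rewrite (le_trans (T1 _ _))// vN.
Qed.

Lemma prepend_delta (j : int) (x : config) m c :
  clear_above j x -> x j = (m.+1, c) ->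
  prepend j (delta (upd x j (m, c))) = delta x :> H.
Proof.
move=> zx xj; apply: ell2_eqP => y; rewrite prependE !deltaE.
have [->|yx] := eqVneq y x; first by rewrite zx xj /= eqxx mul1r.
case: (boolP (_ && _)) => [/andP[zy y0]|_]; last by rewrite mul0r.
case: eqVneq => [e|_]; last by rewrite mulr0.
case/negP: yx; apply/eqP/config_eqP => k.
have ek := congr1 (fun z : config => z k) e; rewrite !updE in ek.
have [kj|kj] := eqVneq k j; last by move: ek; rewrite (negbTE kj).
move: ek; rewrite kj eqxx xj; case: (y j) y0 => -[//|m'] c' _ /=.
by case=> -> ->.
Qed.

End Isometries.

(** * The bicommutant has no abelian projection *)

Section NotTypeI.
Context {R : realType} (O : cstarAlgType R) (s : int -> O).
Local Notation C := R[i].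
Local Notation H := (@ell2 R config).
Local Notation B := (bop H).
Hypothesis hO : is_exel_laca (fun i j : int => (j <= i)%R) s.
Variable (f : O -> B).
Hypothesis fh : star_hom f.
Hypothesis fs : forall j, f (s j) = gen j.

Let pi (x : O) : H -> H := f x.

Let fM x y : f (x ** y) = f x ** f y. Proof. by case: fh. Qed.
Let fS x : f (star x) = star (f x). Proof. by case: fh. Qed.
Let fL : linear f. Proof. by case: fh. Qed.
Let fD x y : f (x + y) = f x + f y.
Proof. by have := fL 1 x y; rewrite !scale1r. Qed.
Let fB x y : f (x - y) = f x - f y.
Proof. by have := fL (-1) y x; rewrite !scaleN1r => h;
  rewrite addrC h addrC. Qed.

Lemma bop_bounded_op (T : B) : bounded_op T.
Proof. by apply: norm_bounded_continuous; case: (bopP T). Qed.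

Lemma pi_rep : representation pi.
Proof.
split=> [x|c x y h|x y|x h k].
- exact: bop_bounded_op.
- by rewrite /pi fL.
- by rewrite /pi fM.
- by rewrite /pi fS bop_starP bop_starK.
Qed.

Lemma pi_nondeg : nondegenerate_rep pi.
Proof.
move=> S cS S0 lS Spi; apply: delta_dense => // x.
have [N xN] := config_finsupp x.
have zx : clear_above N.+1%:Z x by apply/asboolP => k Nk; rewrite xN//; lia.
have -> : delta x = pi (star (s N.+1%:Z) ** s N.+1%:Z) (delta x).
  rewrite /pi fM fS fs (gen_star_gen (n := 0))//.
  rewrite -[RHS]/(idop (clear_proj _ (star idop (delta x)))) idop_star !idopE.
  apply: ell2_eqP => y; rewrite clear_projE deltaE.
  by have [->|_] := eqVneq y x; rewrite ?zx ?mul1r ?mulr0.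
exact: Spi.
Qed.

(** Conjugation by 'V' gives a homomorphism with the same values on the
    generators; by the uniqueness in the universal property it is 'f' itself. *)
Lemma symmetry_commutant (V : B) : star V = V -> V ** V = @idop R ->
  (forall j, V ** gen j = gen j ** V) -> commutant (range pi) V.
Proof.
move=> VS VV Vt; split; first exact: bop_bounded_op.
pose g x := V ** f x ** V.
have gh : star_hom g.
  split=> [c x y|x y|x]; rewrite /g.
  - by rewrite fL cmulDr cmulDl cmulZr cmulZl.
  - by rewrite fM !cmulA -(cmulA (V ** f x) V V) VV idop_mulr.
  - by rewrite fS !starM VS cmulA.
have [_ _ /(_ B gen gen_relations)[f' [_ fu]]] := hO.
have fg : f = g.
  rewrite -(fu f)//; apply: fu; split=> // j.
  by rewrite /g fs Vt -(cmulA _ V V) VV idop_mulr.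
move=> _ [x _ <-]; have e : V ** f x = f x ** V.
  by rewrite {2}fg /g -(cmulA _ V V) VV idop_mulr.
exact: (congr1 (fun T : B => T : H -> H) e).
Qed.

Let M := commutant (commutant (range pi)).

Lemma fflip_bit_commutant i : commutant (range pi) (fflip_bit i).
Proof. by apply: symmetry_commutant;
  [exact: fflip_bit_star|exact: fflip_bit_sqr|exact: fflip_bit_gen]. Qed.

Lemma fsign_bit_commutant i : commutant (range pi) (fsign_bit i).
Proof. by apply: symmetry_commutant;
  [exact: fsign_bit_star|exact: fsign_bit_sqr|exact: fsign_bit_gen]. Qed.

(** Let 'V' commute with the representation. On the range of q_k, k = -i, the
    operator 'T' coincides with an element of the representation, so 'V' and 'T'
    commute there. Prepending letters above k, which commutes with both, extends
    this to every configuration above level k, and these exhaust the space. *)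
Lemma bicommutant_of_corner (T : B) i :
  (exists x, T ** (star (gen (level i)) ** gen (level i)) = f x) ->
  (forall j, level i < j -> T ** gen j = gen j ** T) -> M T.
Proof.
move=> [x0 Tq] Tt; split; first exact: bop_bounded_op.
move=> V [[lV cV] Vpi].
have Vf x h : V (f x h) = f x (V h).
  by have := Vpi (pi x) (ex_intro2 _ _ x I erefl) =>
    /(congr1 (fun F : H -> H => F h)).
have Vt j h : V (gen j h) = gen j (V h) by rewrite -fs Vf.
pose u h := T (V h) - V (T h).
have lu : linear u.
  by move=> c h k; rewrite /u lV !bopD !bopZ lV scalerBr addrACA opprD.
have cu : continuous u.
  have [_ cT] := bop_bounded_op T.
  move=> h.
  have TV := @continuous_comp _ _ _ V T h (cV h) (cT _).
  have VT := @continuous_comp _ _ _ T V h (cT h) (cV _).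
  exact: (cvgB TV VT).
have ut j h : level i < j -> u h = 0 -> u (gen j h) = 0.
  move=> ij; rewrite /u Vt => /eqP; rewrite subr_eq0 => /eqP uh.
  have e k : T (gen j k) = gen j (T k).
    exact: (congr1 (fun F : B => F k) (Tt j ij)).
  by rewrite !e Vt uh subrr.
have nk : level i.+1 < level i by rewrite /level; lia.
have uq h : u (framed i.+1 (clear_proj (level i)) h) = 0.
  have qf : framed i.+1 (clear_proj (level i)) =
    f (star (s (level i)) ** s (level i)).
    by rewrite fM fS fs (gen_star_gen nk).
  have e k : T (framed i.+1 (clear_proj (level i)) k) = f x0 k.
    by rewrite -Tq (gen_star_gen nk).
  by rewrite /u {1}qf Vf -qf !e Vf subrr.
(* Induction on the highest letter, then on its multiplicity. *)
have claim d : forall x : config, clear_above (level i + d%:Z) x -> u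
  (frame i.+1 (delta x)) = 0.
  elim: d => [|d IHd] x.
    rewrite addr0 => zx.
    suff <- : clear_proj (level i) (delta x) = delta x :> H by rewrite
      -framed_frame uq.
    apply: ell2_eqP => y; rewrite clear_projE deltaE.
    by have [->|_] := eqVneq y x; rewrite ?zx ?mul1r ?mulr0.
  set j := level i + d.+1%:Z; have ij : level i < j by rewrite /j; lia.
  have jd : j - 1 = level i + d%:Z by rewrite /j; lia.
  move: {2}(x j).1 (erefl (x j).1) => m.
  elim: m x => [|m IHm] x xm zx;
    first by apply: IHd; rewrite -jd clear_above_pred zx xm.
  have xj : x j = (m.+1, (x j).2) by rewrite -xm -surjective_pairing.
  rewrite -(prepend_delta zx xj) -framed_frame.
  have nj : level i.+1 < j by lia.
  rewrite -(gen_framed nj); apply: ut => //.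
  apply: IHm; last by rewrite clear_above_upd_le.
  by rewrite updE eqxx.
have uU v : u (frame i.+1 v) = 0.
  apply: (@delta_ext _ _ _ (fun v => u (frame i.+1 v))) => [c h k|h|x].
  - by rewrite bopD bopZ lu.
  - have [_ cU] := bop_bounded_op (frame i.+1).
    by apply: (continuous_comp (f := frame i.+1)); [exact: cU|exact: cu].
  have [N xN] := config_finsupp x.
  apply: (claim (N + i)%N); apply/asboolP => k Nk; rewrite xN//.
  by rewrite /level in Nk; lia.
apply/funext => h /=; apply/eqP; rewrite -subr_eq0; apply/eqP.
rewrite -/(u h) -(frame_starK i.+1 h); exact: uU.
Qed.

Lemma fflip_mult_bicommutant i : M (fflip_mult i).
Proof.
apply: (@bicommutant_of_corner _ i) => [|j ij]; last exact: framed_level_op_gen.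
pose q j := star (s j) ** s j.
exists (s (level i) ** q (level i - 1) + q (level i - 1) ** star (s (level i))).
by rewrite fflip_mult_corner fD !fM !fS !fs.
Qed.

Lemma fsign_mult_bicommutant i : M (fsign_mult i).
Proof.
apply: (@bicommutant_of_corner _ i) => [|j ij]; last exact: framed_level_op_gen.
pose q j := star (s j) ** s j.
exists (q (level i - 1) - s (level i) ** q (level i - 1) ** star (s (level i))).
by rewrite fsign_mult_corner fB !fM !fS !fs.
Qed.

(** Let e be abelian and v = e v. In e S e T v, with S and T the two Pauli
    operators on the multiplicity at level -i, the operators S and T act
    approximately like their counterparts S' and T' on the bit. These commute
    with e and with S and T, so that e S e T v is close to T' S' v, and
    e T e S v to S' T' v = - T' S' v. Both products agree because e is abelian,
    hence the vector T' S' v, of the same norm as v, is small. *)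
Lemma abelian_projection_eq0 e : abelian_projection M e -> e = cst 0.
Proof.
move=> [[[le ce] ee ea] [_ eM] ab].
have eB v w : e (v - w) = e v - e w.
  by rewrite -scaleN1r addrC le scaleN1r addrC.
have e1 v : `|e v| <= `|v|.
  have [->|ev0] := eqVneq (e v) 0; first by rewrite normr0.
  rewrite -(@ler_pM2r _ `|e v|) ?normr_gt0// -expr2 sqr_norm_hdot ea.
  rewrite -[e (e v)]/((e \o e) v) ee (le_trans (real_ler_norm _)) ?hdot_le//.
  rewrite -[in X in _ X]ee /= -ea -sqr_norm_hdot rpredX// ger0_real//.
pose comm (V : B) := forall v, e (V v) = V (e v).
have eY i : comm (fflip_bit i) by move=> v;
  have /(congr1 (fun F : H -> H => F v)) := eM _ (fflip_bit_commutant i).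
have eW i : comm (fsign_bit i) by move=> v;
  have /(congr1 (fun F : H -> H => F v)) := eM _ (fsign_bit_commutant i).
have XW i (v : H) : fflip_mult (R := R) i (fsign_bit i v) =
  fsign_bit i (fflip_mult i v).
  by have [_ /(_ _ (fsign_bit_commutant i))/(congr1 (fun F : H -> H => F v))]
    := fflip_mult_bicommutant i.
have ZY i (v : H) : fsign_mult (R := R) i (fflip_bit i v) =
  fflip_bit i (fsign_mult i v).
  by have [_ /(_ _ (fflip_bit_commutant i))/(congr1 (fun F : H -> H => F v))]
    := fsign_mult_bicommutant i.
have X1 i (v : H) : `|fflip_mult (R := R) i v| <= `|v| by exact: framed_norm.
have Z1 i (v : H) : `|fsign_mult (R := R) i v| <= `|v| by exact: framed_norm.
have Y1 i (v : H) : `|fflip_bit (R := R) i v| <= `|v| by exact: framed_norm.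
have W1 i (v : H) : `|fsign_bit (R := R) i v| <= `|v| by exact: framed_norm.
have core (S T S' T' : B) v (d : C) : e v = v ->
    comm S' -> comm T' ->
    (forall w, `|S w| <= `|w|) -> (forall w, `|T' w| <= `|w|) ->
    (forall w, S (T' w) = T' (S w)) ->
    `|S v - S' v| <= d -> `|T v - T' v| <= d ->
    `|e (S (e (T v))) - T' (S' v)| <= d + d.
  move=> ev eS' eT' S1 T'1 ST' dS dT.
  have -> : e (S (e (T v))) - T' (S' v) =
      e (S (e (T v - T' v))) + T' (e (S v - S' v)).
    have r1 : e (S (e (T' v))) = T' (e (S v)) by rewrite eT' ev ST' eT'.
    have r2 : e (S' v) = S' v by rewrite eS' ev.
    by rewrite !eB !bopB !eB r1 r2 addrA subrK.
  rewrite (le_trans (ler_normD _ _))// lerD//.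
    by rewrite (le_trans (e1 _))// (le_trans (S1 _))// (le_trans (e1 _)).
  by rewrite (le_trans (T'1 _))// (le_trans (e1 _)).
apply/funext => w; set v := e w.
have ev : e v = v by rewrite /v -[e (e w)]/((e \o e) w) ee.
apply/eqP; rewrite -normr_le0; apply/ler_addgt0Pr => d d0; rewrite add0r.
have d40 : 0 < d / 2 / 2 by rewrite !divr_gt0.
have [N1 h1] := diff_small v d40 X1 Y1 (@fflip_vac R).
have [N2 h2] := diff_small v d40 Z1 W1 (@fsign_vac R).
pose i := maxn N1 N2.
have {}h1 := h1 i (leq_maxl _ _); have {}h2 := h2 i (leq_maxr _ _).
(* The two quarters of d on either side add up to d / 2 in each estimate. *)
have c1 := core (fflip_mult i) (fsign_mult i) (fflip_bit i) (fsign_bit i) v _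
  ev (eY i) (eW i) (X1 i) (W1 i) (XW i) h1 h2.
have c2 := core (fsign_mult i) (fflip_mult i) (fsign_bit i) (fflip_bit i) v _
  ev (eW i) (eY i) (Z1 i) (Y1 i) (ZY i) h2 h1.
have abv : e (fflip_mult i (e (fsign_mult i v))) =
  e (fsign_mult i (e (fflip_mult i v))).
  have := ab _ _ (fflip_mult_bicommutant i) (fsign_mult_bicommutant i).
  move=> /(congr1 (fun F : H -> H => F v)) /=.
  by rewrite ev -![e (e _)]/((e \o e) _) ee.
have YW : fflip_bit i (fsign_bit i v) = - fsign_bit i (fflip_bit i v).
  exact: (congr1 (fun F : B => F v) (fbit_anticommute i)).
rewrite -splitr in c1 c2; rewrite abv in c1; rewrite YW opprK in c2.
have n1 : `|fsign_bit i (fflip_bit i v)| = `|v|.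
  rewrite isometry_norm; last by rewrite fsign_bit_star fsign_bit_sqr.
  by rewrite isometry_norm// fflip_bit_star fflip_bit_sqr.
have : `|fsign_bit i (fflip_bit i v) + fsign_bit i (fflip_bit i v)| <= d.
  set a := e _ in c1 c2.
  have -> : fsign_bit i (fflip_bit i v) + fsign_bit i (fflip_bit i v) =
    (a + fsign_bit i (fflip_bit i v)) - (a - fsign_bit i (fflip_bit i v)).
    by rewrite opprB [RHS]addrC addrA subrK.
  by rewrite [d]splitr (le_trans (ler_normB _ _))// lerD.
rewrite -mulr2n normrMn n1; apply: le_trans.
by rewrite mulr2n lerDl.
Qed.

Lemma zero_config_subproof : (fun=> (0%N, false)) \in finsupp_config.
Proof. by apply/asboolP; exists 0%N. Qed.

(** The identity is a central projection, and it dominates no nonzero abelian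
    projection. *)
Lemma not_type_I_of_rep : ~ type_I O.
Proof.
move=> /(_ H pi pi_rep pi_nondeg) tI.
have id_b : bounded_op (idfun : H -> H) by split=> // x.
have id_c (F : set (H -> H)) : commutant F idfun by split.
have id_p : projection (idfun : H -> H) by split.
have id0 : (idfun : H -> H) <> cst 0.
  pose x := Config zero_config_subproof.
  move=> /(congr1 (fun F : H -> H => F (delta x) x)) /=.
  by rewrite eqxx => /eqP; rewrite oner_eq0.
have [e [ea e0 _]] := tI _ id_p (id_c _) (id_c _) id0.
by apply: e0; exact: abelian_projection_eq0.
Qed.

End NotTypeI.

Theorem corollary2p6 (R : realType) (O : cstarAlgType R) (s : int -> O)
    (hO : is_exel_laca (fun i j : int => (j <= i)%R) s) :
  ~ type_I O.
Proof.
have [_ _ /(_ _ gen gen_relations)[f [[fh fs] _]]] := hO.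
exact: (not_type_I_of_rep hO fh fs).
Qed.
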